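(* Assume $ef>1$ and $q>3$. Let $\tau=\mathrm{ind}_{IZ}^G\mathbf 1/(\mathrm{Im}\,T_{1,2},\mathrm{Ker}\,T_{1,2})$. The right action of the pro-$p$-Iwahori-Hecke algebra $\mathcal H$ on $\tau^{I(1)}$ is given on the vectors $[\mathrm{id},1]$, $[\beta,1]$, $s_n^{p^l}$, $\beta s_n^{p^l}$ ($n\ge2$, $0\le l\le f-1$) by the following formulas, which hold in $\tau$: (1) $[\mathrm{id},1]\cdot T_\beta=[\beta,1]$, $[\beta,1]\cdot T_\beta=[\mathrm{id},1]$, $s_n^{p^l}\cdot T_\beta=\beta s_n^{p^l}$, $\beta s_n^{p^l}\cdot T_\beta=s_n^{p^l}$. (2) $[\mathrm{id},1]\cdot T_{n_s}=0$, $[\beta,1]\cdot T_{n_s}=-[\beta,1]$, $s_n^{p^l}\cdot T_{n_s}=0$, $\beta s_n^{p^l}\cdot T_{n_s}=-s_{n+1}^{p^l}$. (3) For every character $\chi:H\to\mathbb F_q^\times$: $[\mathrm{id},1]\cdot e_\chi$ equals $[\mathrm{id},1]$ if $\chi$ is trivial and $0$ otherwise; $[\beta,1]\cdot e_\chi$ equals $[\beta,1]$ if $\chi$ is trivial and $0$ otherwise; $s_n^{p^l}\cdot e_\chi$ equals $s_n^{p^l}$ if $\chi=(d/a)^{p^l}$ and $0$ otherwise; $\beta s_n^{p^l}\cdot e_\chi$ equals $\beta s_n^{p^l}$ if $\chi=(a/d)^{p^l}$ and $0$ otherwise.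
   Context: Let $p$ be a prime and $F$ a finite extension of $\mathbb Q_p$ with ramification index $e$, residue degree $f$, ring of integers $\mathcal O$, uniformizer $\varpi$ and residue field $\mathbb F_q$, $q=p^f$, with a fixed embedding $\mathbb F_q\hookrightarrow\overline{\mathbb F}_p$. For $x\in\mathbb F_q$, $[x]\in\mathcal O$ is its multiplicative (Teichmüller) representative. For $n\ge1$ put $I_n=\{[\mu_0]+[\mu_1]\varpi+\dots+[\mu_{n-1}]\varpi^{n-1}:\mu_i\in\mathbb F_q\}$, with digits $\mu_i$. $G=\mathrm{GL}_2(F)$, $Z$ its center, $K=\mathrm{GL}_2(\mathcal O)$, $I\subset K$ the Iwahori subgroup (upper triangular mod $\varpi$), $I(1)\subset I$ the pro-$p$-Iwahori subgroup (upper triangular unipotent mod $\varpi$), $H=\{\mathrm{diag}([\lambda],[\mu]):\lambda,\mu\in\mathbb F_q^\times\}$, $\beta=\begin{pmatrix}0&1\\ \varpi&0\end{pmatrix}$, $n_s=\begin{pmatrix}0&-1\\1&0\end{pmatrix}$. The character $\mathrm{diag}([\lambda],[\mu])\mapsto\lambda^r\mu^s$ of $H$ is written $a^rd^s$; so $(d/a)^{p^l}=a^{-p^l}d^{p^l}$. Compact inductions are over $\overline{\mathbb F}_p$; $[g,1]\in\mathrm{ind}_{IZ}^G\mathbf 1$ is the characteristic function of $gIZ$, with $h\cdot[g,1]=[hg,1]$. The operator $T_{1,2}$ on $\mathrm{ind}_{IZ}^G\mathbf 1$ is the $G$-equivariant operator $T_{1,2}[g,1]=\sum_{\lambda\in I_1}\left[g\begin{pmatrix}1&0\\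 \varpi\lambda&\varpi\end{pmatrix},1\right]$, and $(\mathrm{Im}\,T_{1,2},\mathrm{Ker}\,T_{1,2})$ is the sum of the two subrepresentations. For $n\ge1$, $0\le k\le q-1$: $s_n^k=\sum_{\mu\in I_n}\mu_{n-1}^k\left[\begin{pmatrix}\varpi^n&\mu\\0&1\end{pmatrix},1\right]$ (with $0^0=1$). $\mathcal H=\mathrm{End}_G(\mathrm{ind}_{I(1)Z}^G\mathbf 1)$ is generated by $T_\beta$, $T_{n_s}$ and $e_\chi$ ($\chi$ a character of $H$). It acts on the right on $\tau^{I(1)}=\mathrm{Hom}_G(\mathrm{ind}_{I(1)Z}^G\mathbf 1,\tau)$; explicitly, for $v\in\tau^{I(1)}$, $$v\cdot T_\beta=\beta^{-1}v,\qquad v\cdot e_\chi=|H|^{-1}\sum_{h\in H}\chi(h)h^{-1}v,\qquad v\cdot T_{n_s}=\sum_{\lambda\in I_1}\begin{pmatrix}1&\lambda\\0&1\end{pmatrix}n_s^{-1}v.$$ *)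

(* Defs.v *)
From HB Require Import structures.
From mathcomp Require Import all_boot all_order all_algebra all_field.
From mathcomp Require Import finalg ring_quotient.
From mathcomp Require Import finmap all_classical.
From mathcomp Require Import zify ring.

Set Implicit Arguments.
Unset Strict Implicit.
Unset Printing Implicit Defensive.

Import Order.TTheory GRing.Theory Num.Theory.
Local Open Scope ring_scope.
Local Open Scope quotient_scope.

(* The value [nval 0] is irrelevant: 0 is always treated apart, as an element *)
(* of infinite valuation (see [val_ge]).                                      *)
Record nvaluation (F : fieldType) := NValuation {
  nval :> F -> int;
  nvalM : forall x y, x != 0 -> y != 0 -> nval (x * y) = nval x + nval y;
  nvalD : forall x y, x != 0 -> y != 0 -> x + y != 0 ->
    Num.min (nval x) (nval y) <= nval (x + y);
  nval_normalized : exists2 x, x != 0 & nval x = 1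
}.

Section Valuation.
Variables (F : fieldType) (v : nvaluation F).

Definition val_ge (n : int) (x : F) : bool := (x == 0) || (n <= v x).

Definition integers : {pred F} := [pred x | val_ge 0 x].

Definition maxideal : {pred F} := [pred x | val_ge 1 x].

Lemma nval1 : v 1 = 0.
Proof.
have := nvalM v (oner_neq0 F) (oner_neq0 F).
by rewrite mulr1 -{1}[v 1]addr0 => /addrI.
Qed.

Lemma nvalN1 : v (-1) = 0.
Proof.
have n1 : -1 != 0 :> F by rewrite oppr_eq0 oner_neq0.
have := nvalM v n1 n1; rewrite mulrNN mulr1 nval1 -mulr2n => /esym/eqP.
by rewrite mulrn_eq0 /= => /eqP.
Qed.

Lemma val_geM m n x y : val_ge m x -> val_ge n y -> val_ge (m + n) (x * y).
Proof.
rewrite /val_ge mulf_eq0.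
have [->//|x0] := eqVneq x 0; have [->|y0 /= vx vy] := eqVneq y 0.
  by rewrite orbT.
by rewrite nvalM // lerD.
Qed.

Lemma val_geN n x : val_ge n x -> val_ge n (- x).
Proof.
have -> : val_ge n x = val_ge (0 + n) (- x); last by rewrite add0r.
rewrite add0r /val_ge oppr_eq0; have [//|x0] := eqVneq x 0.
by rewrite -mulN1r nvalM ?oppr_eq0 ?oner_neq0 // nvalN1 add0r.
Qed.

Lemma val_geD n x y : val_ge n x -> val_ge n y -> val_ge n (x + y).
Proof.
rewrite /val_ge; have [->|x0] := eqVneq x 0; first by rewrite add0r.
have [->|y0] := eqVneq y 0; first by rewrite addr0 (negPf x0).
have [//|xy0 /= vx vy] := eqVneq (x + y) 0.
by rewrite (le_trans _ (nvalD v x0 y0 xy0)) // le_min vx vy.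
Qed.

Lemma val_ge0 n : val_ge n 0. Proof. by rewrite /val_ge eqxx. Qed.

Lemma val_geW m n x : m <= n -> val_ge n x -> val_ge m x.
Proof.
by rewrite /val_ge => mn /orP[->//|nx]; rewrite (le_trans mn nx) orbT.
Qed.

Lemma integers1 : 1 \in integers.
Proof. by rewrite inE /val_ge nval1 lexx orbT. Qed.

Definition uniformizer (pi : F) : Prop := pi != 0 /\ v pi = 1.

(* [kF] is the quotient of the valuation ring by its maximal ideal, with      *)
(* quotient map [red]; the values of [red] at non-integers are irrelevant.    *)
Record residue_map (kF : fieldType) (red : F -> kF) : Prop := ResidueMap {
  residue1 : red 1 = 1;
  residueD : {in integers &, {morph red : x y / x + y}};
  residueM : {in integers &, {morph red : x y / x * y}};
  residue_surj : forall a, exists2 x, x \in integers & red x = a;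
  residue_ker : {in integers, forall x, red x = 0 <-> x \in maxideal}
}.

Record teichmuller (kF : fieldType) (red : F -> kF) (teich : kF -> F) : Prop :=
  Teichmuller {
    teich_integer : forall a, teich a \in integers;
    teichK : forall a, red (teich a) = a;
    teichM : {morph teich : a b / a * b}
  }.

Definition val_cauchy (u : nat -> F) : Prop :=
  forall n : int, exists N : nat, forall i j : nat,
    (N <= i)%N -> (N <= j)%N -> val_ge n (u i - u j).

Definition val_converges (u : nat -> F) (x : F) : Prop :=
  forall n : int, exists N : nat, forall i : nat,
    (N <= i)%N -> val_ge n (u i - x).

End Valuation.

(* (Q, w) is the completion of the rationals for the p-adic valuation; this   *)
(* determines it up to a unique isomorphism.                                  *)
Record is_Qp (p : nat) (Q : fieldType) (w : nvaluation Q) : Prop := IsQp {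
  Qp_char0 : forall n, (0 < n)%N -> n%:R != 0 :> Q;
  Qp_val : forall n, (0 < n)%N -> w n%:R = (logn p n)%:Z;
  Qp_dense : forall (x : Q) (n : int), exists r : rat, val_ge w n (x - ratr r);
  Qp_complete : forall u, val_cauchy w u -> exists x, val_converges w u x
}.

(* The normalized valuation of a finite extension of Q_p restricts to e times *)
(* the one of Q_p, e being the ramification index.                            *)
Definition ramification_index (Q : fieldType) (F : fieldExtType Q)
    (w : nvaluation Q) (v : nvaluation F) (e : nat) : Prop :=
  (0 < e)%N /\ forall a : Q, a != 0 -> v (a%:A) = e%:Z * w a.

Section GL2.
Variable F : fieldType.

Record GL2 := MkGL2 { gl2_mx :> 'M[F]_2; gl2_mxP : gl2_mx \in unitmx }.

HB.instance Definition _ := [isSub for gl2_mx].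
HB.instance Definition _ := [Choice of GL2 by <:].

Definition gl2_one := MkGL2 (unitmx1 F 2).

Lemma gl2_mul_subproof (g h : GL2) : gl2_mx g *m gl2_mx h \in unitmx.
Proof. by rewrite unitmx_mul !gl2_mxP. Qed.
Definition gl2_mul g h := MkGL2 (gl2_mul_subproof g h).

Lemma gl2_inv_subproof (g : GL2) : invmx (gl2_mx g) \in unitmx.
Proof. by rewrite unitmx_inv gl2_mxP. Qed.
Definition gl2_inv g := MkGL2 (gl2_inv_subproof g).

Lemma gl2_mulA : associative gl2_mul.
Proof. by move=> x y z; apply: val_inj; rewrite /= mulmxA. Qed.
Lemma gl2_mul1g : left_id gl2_one gl2_mul.
Proof. by move=> x; apply: val_inj; rewrite /= mul1mx. Qed.
Lemma gl2_mulg1 : right_id gl2_one gl2_mul.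
Proof. by move=> x; apply: val_inj; rewrite /= mulmx1. Qed.
Lemma gl2_mulVg : left_inverse gl2_one gl2_inv gl2_mul.
Proof. by move=> x; apply: val_inj; rewrite /= mulVmx ?gl2_mxP. Qed.
Lemma gl2_mulgV : right_inverse gl2_one gl2_inv gl2_mul.
Proof. by move=> x; apply: val_inj; rewrite /= mulmxV ?gl2_mxP. Qed.

HB.instance Definition _ :=
  isGroup.Build GL2 gl2_mulA gl2_mul1g gl2_mulg1 gl2_mulVg gl2_mulgV.

Definition mx2 (a b c d : F) : 'M[F]_2 :=
  \matrix_(i, j) if i == 0 then (if j == 0 then a else b)
                 else (if j == 0 then c else d).

(* The element of GL_2(F) with matrix A when A is invertible (it is below),   *)
(* and the identity otherwise.                                                *)
Definition GL2_of (A : 'M[F]_2) : GL2 := insubd gl2_one A.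

Lemma GL2_ofE A : A \in unitmx -> GL2_of A = A :> 'M_2.
Proof. by move=> uA; rewrite /GL2_of val_insubd uA. Qed.

Lemma det_mx2 a b c d : \det (mx2 a b c d) = a * d - b * c.
Proof.
rewrite (expand_det_row _ 0) big_ord_recl big_ord1 /cofactor !det_mx11 !mxE /=.
by rewrite /= expr0 expr1 mul1r mulN1r mulrN.
Qed.

Lemma mx2E (A : 'M[F]_2) : A = mx2 (A 0 0) (A 0 1) (A 1 0) (A 1 1).
Proof.
by apply/matrixP => -[[|[|//]] i] [[|[|//]] j]; rewrite mxE /=;
  congr (A _ _); apply: val_inj.
Qed.

Lemma mx2_1 : 1%:M = mx2 1 0 0 1.
Proof. by rewrite [LHS]mx2E !mxE. Qed.

Lemma mulmx_mx2 a b c d a' b' c' d' :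
  mx2 a b c d *m mx2 a' b' c' d' =
  mx2 (a * a' + b * c') (a * b' + b * d') (c * a' + d * c') (c * b' + d * d').
Proof. by rewrite [LHS]mx2E !mxE !big_ord_recl !big_ord0 !mxE /= !addr0. Qed.

Definition gl2 (a b c d : F) : GL2 := GL2_of (mx2 a b c d).

Lemma gl2E a b c d : a * d - b * c != 0 -> gl2 a b c d = mx2 a b c d :> 'M_2.
Proof. by move=> nz; rewrite GL2_ofE // unitmxE det_mx2 unitfE. Qed.

Lemma gl2_mx1 : gl2_mx 1%g = 1%:M. Proof. by []. Qed.
Lemma gl2_mxM (g h : GL2) : gl2_mx (g * h)%g = gl2_mx g *m gl2_mx h.
Proof. by []. Qed.
Lemma gl2_mxV (g : GL2) : gl2_mx g^-1%g = invmx (gl2_mx g). Proof. by []. Qed.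

End GL2.

Section Subgroups.
Variables (F : fieldType) (v : nvaluation F).
Notation G := (GL2 F).

Definition center_GL2 : {pred G} :=
  [pred g | `[< exists c : F, gl2_mx g = c%:M >]].

Definition maxcompact : {pred G} :=
  [pred g : G | [forall i, forall j,
     (g i j \in integers v) && ((g^-1)%g i j \in integers v)]].

Definition iwahori : {pred G} :=
  [pred g : G | (g \in maxcompact) && (g 1 0 \in maxideal v)].

Definition propiwahori : {pred G} :=
  [pred g : G | (g \in iwahori) &&
     [forall i, g i i - 1 \in maxideal v]].

Definition iwahoriZ : {pred G} :=
  [pred g | `[< exists x z, [/\ x \in iwahori, z \in center_GL2
                               & g = (x * z)%g] >]].

Lemma center_comm (z g : G) : z \in center_GL2 -> (z * g = g * z)%g.
Proof.
move=> /asboolP[c zc]; apply: val_inj.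
by rewrite /= zc scalar_mxC.
Qed.

Lemma center_closed1 : (1 : G)%g \in center_GL2.
Proof. by apply/asboolP; exists 1. Qed.

Lemma center_closedM (x y : G) :
  x \in center_GL2 -> y \in center_GL2 -> (x * y)%g \in center_GL2.
Proof.
move=> /asboolP[a xa] /asboolP[b yb]; apply/asboolP.
by exists (a * b); rewrite gl2_mxM xa yb -scalar_mxM.
Qed.

Lemma center_closedV (x : G) : x \in center_GL2 -> (x^-1)%g \in center_GL2.
Proof.
move=> /asboolP[a xa]; apply/asboolP; exists a^-1.
by rewrite gl2_mxV xa invmx_scalar.
Qed.

Lemma iwahoriP (g : G) :
  reflect [/\ forall i j, g i j \in integers v,
              forall i j, (g^-1)%g i j \in integers v & g 1 0 \in maxideal v]
          (g \in iwahori).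
Proof.
apply: (iffP andP) => [[/forallP gO gm]|[gO gVO gm]]; split => //.
- by move=> i j; have /forallP/(_ j)/andP[] := gO i.
- by move=> i j; have /forallP/(_ j)/andP[] := gO i.
- by apply/forallP => i; apply/forallP => j; rewrite gO gVO.
Qed.

Lemma integersM : {in integers v &, forall x y, x * y \in integers v}.
Proof. by move=> x y xO yO; have := val_geM xO yO. Qed.
Lemma integersD : {in integers v &, forall x y, x + y \in integers v}.
Proof. by move=> x y; apply: val_geD. Qed.
Lemma maxidealMl : forall x y, x \in maxideal v -> y \in integers v ->
  x * y \in maxideal v.
Proof. by move=> x y xO yO; have := val_geM xO yO. Qed.
Lemma maxidealMr : forall x y, x \in integers v -> y \in maxideal v ->
  x * y \in maxideal v.
Proof. by move=> x y xO yO; have := val_geM xO yO. Qed.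

Lemma iwahori_closed1 : (1 : G)%g \in iwahori.
Proof.
have E (i j : 'I_2) : (1%:M : 'M[F]_2) i j \in integers v.
  by rewrite mxE; case: (_ == _); rewrite ?integers1 //; apply: val_ge0.
apply/iwahoriP; split=> [i j|i j|]; first exact: E.
  by rewrite invg1; apply: E.
by rewrite gl2_mx1 mxE; apply: val_ge0.
Qed.

Lemma iwahori_closedM (x y : G) :
  x \in iwahori -> y \in iwahori -> (x * y)%g \in iwahori.
Proof.
move=> /iwahoriP[xO xVO xm] /iwahoriP[yO yVO ym]; apply/iwahoriP; split.
- move=> i j; rewrite gl2_mxM mxE big_ord_recl big_ord1.
  by apply: integersD; apply: integersM.
- move=> i j; rewrite invgM gl2_mxM mxE big_ord_recl big_ord1.
  by apply: integersD; apply: integersM.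
- rewrite gl2_mxM mxE big_ord_recl big_ord1; apply: val_geD.
    exact: maxidealMl.
  have -> : lift ord0 ord0 = 1 :> 'I_2 by apply: val_inj.
  exact: maxidealMr.
Qed.

Lemma iwahori_closedV (x : G) : x \in iwahori -> (x^-1)%g \in iwahori.
Proof.
move=> /iwahoriP[xO xVO xm]; apply/iwahoriP; rewrite invgK; split => //.
set y := (x^-1)%g in xVO *.
have E i j : (y i 0 * x 0 j + y i 1 * x 1 j) = (i == j)%:R.
  have := congr1 (fun g : G => gl2_mx g i j) (mulVg x).
  rewrite gl2_mxM gl2_mx1 !mxE big_ord_recl big_ord1.
  by have -> : lift ord0 ord0 = 1 :> 'I_2 by apply: val_inj.
have e10 := E 1 0; have e00 := E 0 0.
have -> : y 1 0 = y 0 0 * (- (y 1 1 * x 1 0)) + y 1 0 * (y 0 1 * x 1 0).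
  have -> : - (y 1 1 * x 1 0) = y 1 0 * x 0 0.
    by move/eqP: e10; rewrite addr_eq0 => /eqP ->.
  by rewrite [y 0 0 * _]mulrCA -mulrDr e00 mulr1.
apply: val_geD.
  by apply: maxidealMr => //; apply: val_geN; apply: maxidealMr.
by do 2! apply: maxidealMr => //.
Qed.

Lemma iwahoriZ_closed1 : (1 : G)%g \in iwahoriZ.
Proof.
apply/asboolP; exists 1%g, 1%g.
by rewrite mulg1 iwahori_closed1 center_closed1.
Qed.

Lemma iwahoriZ_closedM : {in iwahoriZ &, forall x y, (x * y)%g \in iwahoriZ}.
Proof.
move=> x y /asboolP[x1 [z1 [x1I z1Z ->]]].
move=> /asboolP[x2 [z2 [x2I z2Z ->]]]; apply/asboolP.
exists (x1 * x2)%g, (z1 * z2)%g; rewrite iwahori_closedM ?center_closedM //.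
by split=> //; rewrite -!mulgA (mulgA z1 x2) (center_comm x2 z1Z) !mulgA.
Qed.

Lemma iwahoriZ_closedV : {in iwahoriZ, forall x, (x^-1)%g \in iwahoriZ}.
Proof.
move=> x /asboolP[x1 [z1 [x1I z1Z ->]]]; apply/asboolP.
exists x1^-1%g, z1^-1%g; rewrite iwahori_closedV ?center_closedV //.
by split=> //; rewrite invgM (center_comm _ (center_closedV z1Z)).
Qed.

HB.instance Definition _ := isMulClosed.Build G iwahoriZ iwahoriZ_closedM.
HB.instance Definition _ := isMul1Closed.Build G iwahoriZ iwahoriZ_closed1.
HB.instance Definition _ := isInvClosed.Build G iwahoriZ iwahoriZ_closedV.

End Subgroups.

(* ind_J^G 1 is the space of the functions on G which are right invariant     *)
(* under J and supported on finitely many cosets g J; G acts by left          *)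
(* translation, so that h [g,1] = [hg,1].                                     *)
Section CompactInduction.
Variables (k : fieldType) (G : groupType) (J : groupClosed G).

Definition ind_pred : {pred G -> k^o} := fun f =>
  `[< (forall x y, y \in J -> f (x * y)%g = f x) /\
      exists s : seq G, forall x, f x != 0 ->
        exists2 y, y \in s & (y^-1 * x)%g \in J >].

Lemma ind_pred_submod : subsemimod_closed ind_pred.
Proof.
split; first split.
- by apply/asboolP; split=> // ; exists [::] => x /eqP[].
- move=> f g /asboolP[fJ [s fs]] /asboolP[gJ [t gt]]; apply/asboolP; split.
    by move=> x y yJ; rewrite !fctE fJ ?gJ.
  exists (s ++ t) => x; rewrite fctE.
  have [fx0|fx _] := eqVneq (f x) 0.
    rewrite fx0 add0r => /gt[y yt yx]; exists y => //.
    by rewrite mem_cat yt orbT.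
  by have [y ys yx] := fs x fx; exists y; rewrite ?mem_cat ?ys.
- move=> a f /asboolP[fJ [s fs]]; apply/asboolP; split.
    by move=> x y yJ; rewrite !fctE fJ.
  exists s => x; rewrite fctE => afx; apply: fs; apply: contraNneq afx => ->.
  by rewrite scaler0.
Qed.

HB.instance Definition _ :=
  GRing.isSubmodClosed.Build k (G -> k^o) ind_pred ind_pred_submod.

Record ind := MkInd { ind_fun :> G -> k^o; ind_funP : ind_fun \in ind_pred }.

HB.instance Definition _ := [isSub for ind_fun].
HB.instance Definition _ := [Choice of ind by <:].
HB.instance Definition _ := [SubChoice_isSubLmodule of ind by <:].

Lemma indP (f : ind) : (forall x y, y \in J -> f (x * y)%g = f x) /\
  exists s : seq G, forall x, f x != 0 ->
    exists2 y, y \in s & (y^-1 * x)%g \in J.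
Proof. exact/asboolP/ind_funP. Qed.

Lemma brk_subproof (g : G) :
  (fun x => ((g^-1 * x)%g \in J)%:R : k^o) \in ind_pred.
Proof.
apply/asboolP; split=> [x y yJ|]; first by rewrite mulgA gpredMr.
exists [:: g] => x gx; exists g; first exact: mem_head.
by apply: contraNT gx => /negPf ->.
Qed.

(* [g,1], the characteristic function of the coset g J *)
Definition brk (g : G) : ind := MkInd (brk_subproof g).

Lemma ind_act_subproof (g : G) (f : ind) :
  (fun x => f (g^-1 * x)%g : k^o) \in ind_pred.
Proof.
have [fJ [s fs]] := indP f; apply/asboolP; split=> [x y yJ|].
  by rewrite mulgA fJ.
exists [seq (g * y)%g | y <- s] => x /fs[y ys yx].
by exists (g * y)%g; rewrite ?map_f // invgM -mulgA.
Qed.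

Definition ind_act (g : G) (f : ind) : ind := MkInd (ind_act_subproof g f).

Lemma ind_act_brk g h : ind_act g (brk h) = brk (g * h)%g.
Proof. by apply/val_inj/funext => x; rewrite /= invgM mulgA. Qed.

Definition coset_rep (x : G) : G :=
  xget 1%g [set y | (x^-1 * y)%g \in J]%classic.

Definition coset_reps : set G := [set x | coset_rep x = x]%classic.

Lemma coset_repP x : (x^-1 * coset_rep x)%g \in J.
Proof.
have xJ : (x^-1 * x)%g \in J by rewrite mulVg gpred1.
exact: (@xgetI _ 1%g [set y | (x^-1 * y)%g \in J]%classic x xJ).
Qed.

Lemma eq_coset_rep x y : (x^-1 * y)%g \in J -> coset_rep x = coset_rep y.
Proof.
move=> xy; congr xget; apply/funext => z; apply/propext => /=.
by rewrite -(gpredMl (y^-1 * z)%g xy) -mulgA mulVKg.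
Qed.

(* The linear extension f |-> \sum_(x J) f(x) phi(x) to ind_J^G 1 of          *)
(* [g,1] |-> phi(g), where phi is meant to be constant on the cosets g J.     *)
Definition ind_extend (V : lmodType k) (phi : G -> V) (f : ind) : V :=
  \sum_(x \in coset_reps) (f x : k) *: phi x.

Lemma finite_supp_reps (f : ind) :
  finite_set (coset_reps `&` [set x | f x != 0])%classic.
Proof.
have [_ [s fs]] := indP f.
apply: (@sub_finite_set _ _ [set` map (@coset_rep) s]%classic) => //.
move=> x [/= xr /fs[y ys yx]]; apply/mapP; exists y => //.
by rewrite (eq_coset_rep yx).
Qed.

Lemma ind_extendE (V : lmodType k) (phi : G -> V) (D : set G) (f : ind) :
  (D `<=` coset_reps)%classic -> finite_set D ->
  (forall x, coset_reps x -> f x != 0 -> D x) ->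
  ind_extend phi f = \sum_(x <- fset_set D) (f x : k) *: phi x.
Proof.
move=> Dr finD fD; rewrite -fsbig_finite //; apply/esym/fsbig_widen => //.
move=> x [xr xD] /=; have [->|/(fD x xr)//] := eqVneq (f x) 0.
by rewrite scale0r.
Qed.

Lemma ind_extend_is_linear (V : lmodType k) (phi : G -> V) :
  linear (ind_extend phi).
Proof.
move=> a f g.
pose D := ((coset_reps `&` [set x | f x != 0]) `|`
           (coset_reps `&` [set x | g x != 0]))%classic.
have finD : finite_set D by rewrite finite_setU; split; apply: finite_supp_reps.
have Dr : (D `<=` coset_reps)%classic by move=> x [[]|[]].
rewrite !(ind_extendE _ Dr finD).
- rewrite scaler_sumr -big_split; apply: eq_bigr => x _ /=.
  by rewrite -[LHS]/((a * f x + g x) *: phi x) scalerDl scalerA.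
- by move=> x xr gx; right.
- by move=> x xr fx; left.
- move=> x xr; have [fx0|fx _] := eqVneq (f x) 0; last by left.
  have -> : (a *: f + g) x = a *: (f x : k^o) + g x by [].
  by rewrite fx0 scaler0 add0r => gx; right.
Qed.

HB.instance Definition _ (V : lmodType k) (phi : G -> V) :=
  GRing.isLinear.Build k ind V *:%R (ind_extend phi) (ind_extend_is_linear phi).

Lemma ind_act_is_linear g : linear (ind_act g).
Proof. by move=> a f f'; apply/val_inj/funext. Qed.

HB.instance Definition _ g :=
  GRing.isLinear.Build k ind ind *:%R (ind_act g) (ind_act_is_linear g).

Lemma ind_act1 f : ind_act 1 f = f.
Proof. by apply/val_inj/funext => x; rewrite /= invg1 mul1g. Qed.

Lemma ind_actM g h f : ind_act (g * h)%g f = ind_act g (ind_act h f).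
Proof. by apply/val_inj/funext => x; rewrite /= invgM mulgA. Qed.

Lemma eq_brk g h : (g^-1 * h)%g \in J -> brk g = brk h.
Proof.
move=> gh; apply/val_inj/funext => x /=.
by rewrite -(gpredMl (h^-1 * x)%g gh) -mulgA mulVKg.
Qed.

Lemma ind_extend_brk (V : lmodType k) (phi : G -> V) g :
  (forall x y, y \in J -> phi (x * y)%g = phi x) ->
  ind_extend phi (brk g) = phi g.
Proof.
move=> phiJ; have gJ := coset_repP g.
have rr : coset_reps (coset_rep g).
  by rewrite /coset_reps /=; apply/esym/eq_coset_rep.
rewrite (@ind_extendE _ _ [set coset_rep g]%classic) //.
- rewrite fset_set1 big_seq_fset1 /= gJ scale1r.
  by rewrite -[in LHS](mulVKg g (coset_rep g)) phiJ.
- by move=> _ ->.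
- move=> x xr gx; rewrite /= -[LHS]xr; apply/esym/eq_coset_rep.
  by apply: contraNT gx => /negPf /= ->.
Qed.

Lemma ind_expand f : ind_extend brk f = f.
Proof.
apply/val_inj/funext => y.
pose D := ((coset_reps `&` [set x | f x != 0]) `|` [set coset_rep y])%classic.
have finD : finite_set D.
  by rewrite finite_setU; split; [apply: finite_supp_reps | apply: finite_set1].
have yr : coset_reps (coset_rep y).
  by rewrite /coset_reps /=; apply/esym/eq_coset_rep/coset_repP.
have Dr : (D `<=` coset_reps)%classic by move=> x [[]|-> ].
rewrite (ind_extendE _ Dr finD); last by move=> x xr fx; left.
have yD : coset_rep y \in fset_set D by rewrite in_fset_set // inE; right.
have ev (s : seq G) : val (\sum_(x <- s) (f x : k) *: brk x) y =
    \sum_(x <- s) f x * ((x^-1 * y)%g \in J)%:R.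
  by elim: s => [|x s IHs]; rewrite ?big_nil // !big_cons -IHs.
rewrite ev (bigD1_seq _ yD (fset_uniq _)) /= big1_seq ?addr0.
  have yJ := coset_repP y; rewrite -(gpredV J) invgM invgK in yJ.
  rewrite yJ mulr1 -[in LHS](mulVKg y (coset_rep y)).
  by have [fJ _] := indP f; rewrite fJ ?coset_repP.
move=> x /andP[xy]; rewrite in_fset_set // inE => xD.
have xr := Dr _ xD; have [xyJ|_] := boolP ((x^-1 * y)%g \in J).
  by rewrite -(eq_coset_rep xyJ) xr eqxx in xy.
by rewrite mulr0.
Qed.

(* A linear extension commutes with G when it does so on the [g,1].           *)
Lemma ind_extend_act (phi : G -> ind) (g : G) (f : ind) :
  (forall x y, y \in J -> phi (x * y)%g = phi x) ->
  (forall x, phi (g * x)%g = ind_act g (phi x)) ->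
  ind_extend phi (ind_act g f) = ind_act g (ind_extend phi f).
Proof.
move=> phiJ phig; have finD := finite_supp_reps f.
have extE (V : lmodType k) (psi : G -> V) :=
  @ind_extendE V psi _ f (@subIsetl _ _ _) finD (fun x xr fx => conj xr fx).
rewrite extE -[f in LHS]ind_expand extE !linear_sum; apply: eq_bigr => x _.
have E : ind_extend phi (ind_act g (brk x)) = ind_act g (phi x).
  by rewrite ind_act_brk ind_extend_brk // phig.
by rewrite !linearZ_LR; exact: (congr1 (GRing.scale (f x : k)) E).
Qed.

End CompactInduction.

Section Hecke.
Variables (F : fieldType) (varpi : F) (kF : finFieldType) (teich : kF -> F).
Variables (k : fieldType) (iota : kF -> k).

Definition beta : GL2 F := gl2 0 1 varpi 0.
Definition n_s : GL2 F := gl2 0 (-1) 1 0.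
Definition unip (lambda : kF) : GL2 F := gl2 1 (teich lambda) 0 1.

(* The group H of the diag([lambda],[mu]), indexed by the pairs (lambda, mu)  *)
(* of units of the residue field.                                             *)
Notation H := ({unit kF} * {unit kF})%type.

Definition diagH (x : H) : GL2 F := gl2 (teich (val x.1)) 0 0 (teich (val x.2)).

(* the characters (d/a)^m and (a/d)^m of H *)
Definition char_d_over_a (m : nat) (x : H) : {unit kF} := (x.1 ^- m * x.2 ^+ m)%g.
Definition char_a_over_d (m : nat) (x : H) : {unit kF} := (x.1 ^+ m * x.2 ^- m)%g.

Definition char1 (x : H) : {unit kF} := 1%g.

Definition is_char_of_H (chi : H -> {unit kF}) : Prop :=
  forall x y : H, chi (x.1 * y.1, x.2 * y.2)%g = (chi x * chi y)%g.

(* Hecke operators acting on the right on V^I(1), where [act] is a            *)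
(* representation of GL_2(F) on V. By Frobenius reciprocity V^I(1) is         *)
(* Hom_G(ind_{I(1)Z}^G 1, V) when Z acts trivially, and End_G(ind_{I(1)Z}^G 1) *)
(* acts on the latter by composition; on vectors this gives the formulas      *)
(* below, which are only meant for x in V^I(1).                               *)
Variables (V : lmodType k) (act : GL2 F -> V -> V).

Definition hecke_beta (x : V) : V := act beta^-1%g x.

Definition hecke_ns (x : V) : V :=
  \sum_(lambda : kF) act (unip lambda * n_s^-1)%g x.

Definition hecke_e (chi : H -> {unit kF}) (x : V) : V :=
  (#|{: H}|%:R)^-1 *:
    \sum_(h : H) iota (val (chi h)) *: act (diagH h)^-1%g x.

Definition invariant_under (S : {pred GL2 F}) (x : V) : Prop :=
  {in S, forall g, act g x = x}.

End Hecke.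

Section Tau.
Variables (F : fieldType) (v : nvaluation F) (varpi : F).
Variables (kF : finFieldType) (teich : kF -> F) (k : fieldType).
Notation G := (GL2 F).

Definition indIZ := ind k (iwahoriZ v).
HB.instance Definition _ := GRing.Lmodule.on indIZ.

Definition br (g : G) : indIZ := brk k (iwahoriZ v) g.

(* T_{1,2} [g,1]; see [T12_br] for the formula and [T12_act] for the          *)
(* equivariance of the operator T12 below.                                    *)
Definition T12_brk (g : G) : indIZ :=
  \sum_(lambda : kF) br (g * gl2 1 0 (varpi * teich lambda) varpi)%g.

Definition T12 : indIZ -> indIZ := ind_extend T12_brk.
HB.instance Definition _ := GRing.Linear.on T12.

Definition ImKer : {pred indIZ} := fun f =>
  `[< exists a b : indIZ, T12 b = 0 /\ f = T12 a + b >].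

Lemma ImKer_submod : subsemimod_closed ImKer.
Proof.
split; first split.
- by apply/asboolP; exists 0, 0; rewrite !linear0 addr0.
- move=> _ _ /asboolP[a [b [b0 ->]]] /asboolP[c [d [d0 ->]]]; apply/asboolP.
  by exists (a + c), (b + d); rewrite !(linearD T12) /= b0 d0 addr0 addrACA.
- move=> x _ /asboolP[a [b [b0 ->]]]; apply/asboolP.
  by exists (x *: a), (x *: b); rewrite !(linearZ_LR T12) /= b0 scaler0 scalerDr.
Qed.

HB.instance Definition _ := GRing.isSubmodClosed.Build k indIZ ImKer ImKer_submod.

Definition tau : Type := Quotient.quot ImKer.
HB.instance Definition _ := GRing.Zmodule.on tau.

Definition cls (f : indIZ) : tau := \pi_(tau) f.

Lemma cls_eqP (f g : indIZ) : reflect (cls f = cls g) (f - g \in ImKer).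
Proof. by rewrite Quotient.idealrBE; apply: eqP. Qed.

Lemma clsP (x : tau) : exists f, x = cls f.
Proof. by exists (repr x); rewrite /cls reprK. Qed.

Lemma clsD f g : cls (f + g) = cls f + cls g.
Proof. exact: (raddfD (\pi_(tau))). Qed.

Definition tau_scale (a : k) (x : tau) : tau := cls (a *: repr x).

Lemma tau_scale_cls a f : tau_scale a (cls f) = cls (a *: f).
Proof.
apply/cls_eqP; rewrite -scalerBr; apply: rpredZ; apply/cls_eqP.
exact: reprK.
Qed.

Lemma tau_scaleA a b x : tau_scale a (tau_scale b x) = tau_scale (a * b) x.
Proof. by have [f ->] := clsP x; rewrite !tau_scale_cls scalerA. Qed.
Lemma tau_scale1 : left_id 1 tau_scale.
Proof. by move=> x; have [f ->] := clsP x; rewrite !tau_scale_cls scale1r. Qed.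
Lemma tau_scaleDr : right_distributive tau_scale +%R.
Proof.
move=> a x y; have [f ->] := clsP x; have [g ->] := clsP y.
by rewrite -clsD !tau_scale_cls scalerDr clsD.
Qed.
Lemma tau_scaleDl x : {morph tau_scale^~ x : a b / a + b}.
Proof.
by move=> a b; have [f ->] := clsP x; rewrite !tau_scale_cls scalerDl clsD.
Qed.

HB.instance Definition _ := GRing.Zmodule_isLmodule.Build k tau
  tau_scaleA tau_scale1 tau_scaleDr tau_scaleDl.

Lemma cls_is_linear : linear cls.
Proof. by move=> a f g; rewrite clsD -tau_scale_cls. Qed.
HB.instance Definition _ := GRing.isLinear.Build k indIZ tau *:%R cls cls_is_linear.

(* g acts on tau through any representative; see [tau_act_cls].               *)
Definition tau_act (g : G) (x : tau) : tau := cls (ind_act g (repr x)).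

(* Distinct digits mu give distinct elements of I_n, which is thus indexed    *)
(* by the n-tuples of elements of the residue field.                          *)
Definition of_digits n (mu : n.-tuple kF) : F :=
  \sum_(i < n) teich (tnth mu i) * varpi ^+ i.

(* s_n^r for n >= 1: the exponent r is that of the last digit.                *)
Definition s_vec (iota : kF -> k) (n r : nat) : indIZ :=
  \sum_(mu : n.-tuple kF)
    iota (nth 0 mu n.-1) ^+ r *: br (gl2 (varpi ^+ n) (of_digits mu) 0 1).

End Tau.

Arguments br {F} v k g.
Arguments T12_brk {F} v varpi {kF} teich k g.
Arguments T12 {F} v varpi {kF} teich k f.
Arguments ImKer {F} v varpi {kF} teich k _.
Arguments tau {F} v varpi {kF} teich k.
Arguments cls {F v} varpi {kF} teich {k} f.
Arguments tau_act {F v varpi kF teich k} g x.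
Arguments s_vec {F} v varpi {kF} teich {k} iota n r.

(* T_{1,2} is well defined and G-equivariant, hence G acts on tau.            *)
Section T12Equivariant.
Variables (F : fieldType) (v : nvaluation F) (varpi : F).
Variables (kF : finFieldType) (red : F -> kF) (teich : kF -> F).
Variable k : fieldType.
Hypotheses (hpi : uniformizer v varpi) (hred : residue_map v red).
Hypothesis hteich : teichmuller v red teich.
Notation G := (GL2 F).

Let t (a : kF) : G := gl2 1 0 (varpi * teich a) varpi.

Let tE a : t a = mx2 1 0 (varpi * teich a) varpi :> 'M_2.
Proof. by rewrite gl2E // mul1r mul0r subr0; case: hpi. Qed.

Let tVE a : (t a)^-1%g = mx2 1 0 (- teich a) varpi^-1 :> 'M_2.
Proof.
have [pi0 _] := hpi.
pose u : G := gl2 1 0 (- teich a) varpi^-1.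
have uE : u = mx2 1 0 (- teich a) varpi^-1 :> 'M_2.
  by rewrite gl2E // mul1r mul0r subr0 invr_eq0.
suff -> : ((t a)^-1 = u)%g by [].
rewrite -[LHS]mulg1 -[RHS](mulKg (t a)); congr (_ * _)%g; apply: val_inj.
rewrite [RHS]gl2_mxM uE tE mulmx_mx2 [LHS]mx2_1.
by congr mx2; rewrite /=; field.
Qed.

Lemma maxideal_divpi x : x \in maxideal v -> x / varpi \in integers v.
Proof.
have [pi0 vpi] := hpi; rewrite !inE /val_ge mulf_eq0 invr_eq0 (negPf pi0) orbF.
have [//|x0 /= vx] := eqVneq x 0.
have := nvalM v (x := x / varpi) (y := varpi).
by rewrite divfK // mulf_neq0 ?invr_eq0 // vpi => /(_ isT pi0); lia.
Qed.

Let integersN x : x \in integers v -> - x \in integers v.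
Proof. exact: val_geN. Qed.
Let maxidealW x : x \in maxideal v -> x \in integers v.
Proof. by apply: val_geW. Qed.
Let varpi_max : varpi \in maxideal v.
Proof. by rewrite inE /val_ge; have [_ ->] := hpi; rewrite lexx orbT. Qed.
Let varpi_int : varpi \in integers v. Proof. exact: maxidealW. Qed.

Let conjE (x : G) a b : ((t b)^-1 * (x * t a))%g =
  mx2 (x 0 0 + x 0 1 * (varpi * teich a)) (x 0 1 * varpi)
      (- teich b * (x 0 0 + x 0 1 * (varpi * teich a))
        + x 1 0 / varpi + x 1 1 * teich a)
      (- teich b * (x 0 1 * varpi) + x 1 1) :> 'M_2.
Proof.
have [pi0 _] := hpi; rewrite 2!gl2_mxM tVE tE [gl2_mx x]mx2E !mulmx_mx2.
by congr mx2; rewrite !mxE /=; field.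
Qed.

Let conj_int (x : G) a b : x \in iwahori v ->
  forall i j, ((t b)^-1 * (x * t a))%g i j \in integers v.
Proof.
move=> /iwahoriP[xO _ xm]; have tO := teich_integer hteich.
have tN c : - teich c \in integers v by apply: integersN.
have A : x 0 0 + x 0 1 * (varpi * teich a) \in integers v.
  by apply: integersD => //; do 2! apply: integersM => //.
move=> i j; rewrite conjE mxE.
case: ifP => _; case: ifP => _ //; first exact: integersM.
  apply: integersD; last exact: integersM.
  by apply: integersD; [exact: integersM | exact: maxideal_divpi].
by apply: integersD => //; do 2! apply: integersM => //.
Qed.

Let sigma (x : G) (a : kF) : kF :=
  (red (x 1 0 / varpi) + red (x 1 1) * a) / red (x 0 0).

Let red_max x : x \in maxideal v -> red x = 0.
Proof. by move=> xm; apply/(residue_ker hred) => //; apply: maxidealW. Qed.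

Let red00 (x : G) : x \in iwahori v -> red (x 0 0) != 0.
Proof.
move=> /iwahoriP[xO xVO xm].
have := congr1 (fun g : G => gl2_mx g 0 0) (mulVg x).
rewrite gl2_mxM [gl2_mx x]mx2E [gl2_mx x^-1%g]mx2E mulmx_mx2 gl2_mx1 mx2_1 !mxE /=.
move=> /(congr1 red); rewrite (residueD hred) ?integersM //.
rewrite !(residueM hred) // (red_max xm) mulr0 addr0 (residue1 hred).
by apply: contra_eq_neq => ->; rewrite mulr0 eq_sym oner_neq0.
Qed.

Let conj_iwahori (x : G) a : x \in iwahori v ->
  ((t (sigma x a))^-1 * (x * t a))%g \in iwahori v.
Proof.
move=> xI; have xVI := iwahori_closedV xI.
have /iwahoriP[xO _ xm] := xI; have tO := teich_integer hteich.
apply/iwahoriP; split; first exact: conj_int.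
  move=> i j; rewrite !invgM invgK -mulgA; exact: conj_int.
set b := sigma x a; have := conj_int a b xI 1 0.
rewrite conjE mxE /=; set y := (_ + _) => yO; apply/(residue_ker hred) => //.
have tN : - teich b \in integers v by apply: integersN.
have A0 : x 0 1 * (varpi * teich a) \in maxideal v.
  by apply: maxidealMr => //; apply: maxidealMl.
have A0' := maxidealW A0.
have A : x 0 0 + x 0 1 * (varpi * teich a) \in integers v by apply: integersD.
have B := maxideal_divpi xm.
have redN z : z \in integers v -> red (- z) = - red z.
  move=> zO; apply/eqP; rewrite -addr_eq0 -(residueD hred) ?integersN //.
  by rewrite addNr red_max //; apply: val_ge0.
have S1 : - teich b * (x 0 0 + x 0 1 * (varpi * teich a)) \in integers v.
  exact: integersM.
have S2 : x 1 1 * teich a \in integers v by apply: integersM.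
rewrite /y (residueD hred (integersD S1 B) S2) (residueD hred S1 B).
rewrite (residueM hred tN A) (residueM hred (xO 1 1) (tO a)).
rewrite (residueD hred (xO 0 0) A0') (red_max A0) addr0 redN //.
rewrite !(teichK hteich) /b /sigma mulNr divfK ?red00 //; ring.
Qed.

Lemma T12_brk_iwahoriZ (x y : G) : y \in iwahoriZ v ->
  T12_brk v varpi teich k (x * y)%g = T12_brk v varpi teich k x.
Proof.
move=> /asboolP[y1 [z [yI zZ ->]]]; rewrite /T12_brk.
have sI : injective (sigma y1).
  move=> a b; rewrite /sigma => /(congr1 (fun u => u * red (y1 0 0))).
  rewrite !divfK ?red00 // => /addrI; apply: mulfI.
  have /iwahoriP[xO xVO xm] := yI.
  have := congr1 (fun g : G => gl2_mx g 1 1) (mulgV y1).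
  rewrite gl2_mxM [gl2_mx y1]mx2E [gl2_mx y1^-1%g]mx2E mulmx_mx2 gl2_mx1 mx2_1 !mxE /=.
  move=> /(congr1 red); rewrite (residueD hred) ?integersM //.
  rewrite !(residueM hred) // (red_max xm) mul0r add0r (residue1 hred).
  by apply: contra_eq_neq => ->; rewrite mul0r eq_sym oner_neq0.
rewrite [RHS](reindex_inj sI); apply: eq_bigr => a _.
rewrite -/(t _) -/(t _); apply/esym/eq_brk.
apply/asboolP; exists ((t (sigma y1 a))^-1 * (y1 * t a))%g, z.
split=> //; first exact: conj_iwahori.
by rewrite !invgM !mulgA mulgVK -!mulgA (center_comm _ zZ).
Qed.

Lemma T12_br g : T12 v varpi teich k (br v k g) = T12_brk v varpi teich k g.
Proof. by apply: ind_extend_brk => x y; apply: T12_brk_iwahoriZ. Qed.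

Lemma T12_act g f :
  T12 v varpi teich k (ind_act g f) = ind_act g (T12 v varpi teich k f).
Proof.
apply: ind_extend_act => [x y|x]; first exact: T12_brk_iwahoriZ.
rewrite /T12_brk linear_sum; apply: eq_bigr => a _.
by rewrite -/(t a) -mulgA; apply/esym/ind_act_brk.
Qed.

Lemma tau_act_cls g (f : indIZ v k) :
  tau_act g (cls varpi teich f) = cls varpi teich (ind_act g f).
Proof.
apply/cls_eqP; rewrite -linearB /=.
have /cls_eqP/asboolP[a [b [b0 ->]]] := reprK (cls varpi teich f).
apply/asboolP; exists (ind_act g a), (ind_act g b).
by rewrite !T12_act b0 linearD linear0.
Qed.

End T12Equivariant.

(* Main.v *)
Require Import Defs.
From HB Require Import structures.
From mathcomp Require Import all_boot all_order all_algebra all_field.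
From mathcomp Require Import all_classical.
From mathcomp Require Import zify ring.

Set Implicit Arguments.
Unset Strict Implicit.
Unset Printing Implicit Defensive.

Import Order.TTheory GRing.Theory Num.Theory.
Local Open Scope ring_scope.

(** In [tau] the class of a coset [gIZ] depends only on the vertex [gKZ] of the
    tree, where K = GL_2(O): the image of T_{1,2} contains, for each edge at a
    vertex, the sum of the q other edges at this vertex, so that each edge
    equals the sum of all q + 1 of them ([vt_flip0]). The kernel of T_{1,2} adds
    the relation that the sum of the q + 1 neighbours of a vertex is zero
    ([sum_neighbours]). Hence [tau] is the space of finitely supported functions
    on the vertices modulo the operator that sums over neighbours, and all the
    formulas are computed there, with the vertices [vtx n y] given by the
    matrices (varpi^n y; 0 1).

    The vector s_{n+1} is the sum of [vtx n.+1 y] weighted by the p^l-th power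
    [phi] of the last digit of [y]. An element (a b; c d) of the Iwahori
    subgroup acts on the vertices through the Mobius map
    y |-> (a y + b) / (c y + d), and the point is that it acts on s_{n+1} by a
    character ([act_s_tau]). Changing [y] in its last digit changes the partial
    sum over this digit by a multiple of a vertex two levels lower
    ([last_digit_sumD]), which forgets the last two digits. Since [phi] is
    additive, what has to vanish is then the sum in F_q, over the digit before
    last, of the errors on the last digit. There are two sources of errors. The
    carries of the addition of Teichmuller representatives add up to q z / varpi,
    which is 0 modulo varpi because e f > 1 ([last_two_digits_sum_congr]). The
    Taylor expansion of the Mobius map contributes a linear and a quadratic term
    in the digit, whose sums over F_q vanish because q > 3
    ([last_two_digits_sum_mobius]).

    The formulas for the Hecke operators follow. All four vectors are
    eigenvectors of the Iwahori subgroup, which gives their invariance under the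
    pro-p-Iwahori subgroup and the action of the idempotents e_chi. That T_{n_s}
    sends beta s_n to - s_{n+1} is the splitting of a sum over digits at the
    first digit ([ns_beta_s_tau]). Finally s_{n+1} is, up to sign, the image of
    beta s_n under T_{n_s}, and the square of T_{n_s} kills the eigenvectors of
    the torus whose character differs from its Weyl conjugate ([ns_s_tau]). *)

(** * Residues and digits *)

Lemma integers_subring (F : fieldType) (v : nvaluation F) :
  subring_closed (integers v).
Proof.
split; [exact: integers1 | | exact: integersM].
by move=> x y xO yO; apply: integersD => //; apply: val_geN.
Qed.

HB.instance Definition _ (F : fieldType) (v : nvaluation F) :=
  GRing.isSubringClosed.Build F (integers v) (integers_subring v).

Section LocalField.
Variables (F : fieldType) (v : nvaluation F) (varpi : F).
Variables (kF : finFieldType) (red : F -> kF) (teich : kF -> F).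
Hypotheses (hpi : uniformizer v varpi) (hred : residue_map v red).
Hypothesis hteich : teichmuller v red teich.
Local Notation O := (integers v).

Lemma maxideal_integer x : x \in maxideal v -> x \in O.
Proof. exact: val_geW. Qed.

Lemma maxideal0 : 0 \in maxideal v. Proof. exact: val_ge0. Qed.

Lemma varpi_neq0 : varpi != 0. Proof. by case: hpi. Qed.

Lemma varpi_maxideal : varpi \in maxideal v.
Proof. by rewrite inE /val_ge; have [_ ->] := hpi; rewrite lexx orbT. Qed.

Lemma varpi_integer : varpi \in O.
Proof. exact/maxideal_integer/varpi_maxideal. Qed.

Lemma teichO a : teich a \in O. Proof. exact: teich_integer hteich a. Qed.

Lemma integersN x : x \in O -> - x \in O. Proof. by rewrite rpredN. Qed.

Lemma integersX n x : x \in O -> x ^+ n \in O. Proof. exact: rpredX. Qed.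

Ltac integral := repeat first
  [ assumption | exact: teichO | exact: varpi_integer | exact: rpred0
  | exact: integers1 | apply: integersD | apply: integersN
  | apply: integersM | apply: integersX ].

Lemma redD x y : x \in O -> y \in O -> red (x + y) = red x + red y.
Proof. exact: residueD hred x y. Qed.

Lemma redM x y : x \in O -> y \in O -> red (x * y) = red x * red y.
Proof. exact: residueM hred x y. Qed.

Lemma red1 : red 1 = 1. Proof. exact: residue1 hred. Qed.

Lemma red_maxideal x : x \in maxideal v -> red x = 0.
Proof.
by move=> xm; apply/(residue_ker hred) => //; apply: maxideal_integer.
Qed.

Lemma red0 : red 0 = 0. Proof. exact/red_maxideal/val_ge0. Qed.

Lemma redN x : x \in O -> red (- x) = - red x.
Proof.
by move=> xO; apply/eqP; rewrite -addr_eq0 -redD ?rpredN // addNr red0.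
Qed.

Lemma redB x y : x \in O -> y \in O -> red (x - y) = red x - red y.
Proof. by move=> xO yO; rewrite redD ?rpredN // redN. Qed.

Lemma red_varpi : red varpi = 0. Proof. exact/red_maxideal/varpi_maxideal. Qed.

Lemma red_teich a : red (teich a) = a. Proof. exact: teichK hteich a. Qed.

Lemma red_sum (T : finType) (f : T -> F) :
  (forall i, f i \in O) -> red (\sum_i f i) = \sum_i red (f i).
Proof.
move=> fO.
suff [] : \sum_i f i \in O /\ red (\sum_i f i) = \sum_i red (f i) by [].
apply: (big_rec2 (fun x y => x \in O /\ red x = y)) => [|i y x _ [xO <-]].
  by rewrite rpred0 red0.
by rewrite redD ?rpredD.
Qed.

Lemma red_eq0 x : x \in O -> red x = 0 -> exists2 z, z \in O & x = varpi * z.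
Proof.
move=> xO /(residue_ker hred xO) xm; exists (x / varpi).
  exact: maxideal_divpi.
by rewrite mulrCA divff ?varpi_neq0 ?mulr1.
Qed.

Lemma maxidealP x :
  reflect (exists2 z, z \in O & x = varpi * z) (x \in maxideal v).
Proof.
apply: (iffP idP) => [xm|[z zO ->]].
  by apply: red_eq0; [exact: maxideal_integer | exact: red_maxideal].
exact/maxidealMl/zO/varpi_maxideal.
Qed.

Lemma red_neq0 x : red x != 0 -> x != 0.
Proof. by apply: contra_neq => ->; rewrite red0. Qed.

Lemma unit_inv_integer x : x \in O -> red x != 0 -> x^-1 \in O.
Proof.
move=> xO rx; have x0 := red_neq0 rx.
have vx : ~~ val_ge v 1 x.
  by apply: contra rx => /red_maxideal ->.
move: xO vx; rewrite !inE /val_ge invr_eq0 (negPf x0) /=.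
have := nvalM v x0 (invr_neq0 x0); rewrite divff // nval1 => /esym/eqP.
rewrite addrC addr_eq0 => /eqP->; rewrite oppr_ge0 -ltNge.
by case: (v x) => // [[|n]].
Qed.

Lemma redV x : x \in O -> red x != 0 -> red x^-1 = (red x)^-1.
Proof.
move=> xO rx; apply: (mulfI rx).
by rewrite -redM ?unit_inv_integer // !divff ?red1 ?red_neq0.
Qed.

Lemma teich0 : teich 0 = 0.
Proof.
apply/eqP/contraT => t0; have /eqP := teichM hteich 0 0; rewrite mul0r.
rewrite -{1}[teich 0]mul1r (inj_eq (mulIf t0)) => /eqP t1.
by have /eqP := red_teich 0; rewrite -t1 red1 oner_eq0.
Qed.

Lemma teich_neq0 a : a != 0 -> teich a != 0.
Proof. by move=> a0; apply: red_neq0; rewrite red_teich. Qed.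

Lemma teich1 : teich 1 = 1.
Proof.
apply: (mulfI (teich_neq0 (oner_neq0 kF))).
by rewrite -(teichM hteich) !mulr1.
Qed.

Lemma teichV a : teich a^-1 = (teich a)^-1.
Proof.
have [->|a0] := eqVneq a 0; first by rewrite invr0 teich0 invr0.
apply: (mulfI (teich_neq0 a0)).
by rewrite -(teichM hteich) !divff ?teich1 ?teich_neq0.
Qed.

Lemma red_congr x y : x \in O -> y \in O -> red x = red y ->
  exists2 z, z \in O & x = y + varpi * z.
Proof.
move=> xO yO xy; have [|z zO E] := @red_eq0 (x - y) (rpredB xO yO).
  by rewrite redB // xy subrr.
by exists z => //; rewrite -E addrC subrK.
Qed.

Local Notation of_digits := (of_digits varpi teich).

Lemma of_digits_cons n a (mu : n.-tuple kF) :
  of_digits (cons_tuple a mu) = teich a + varpi * of_digits mu.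
Proof.
rewrite /Defs.of_digits big_ord_recl tnth0 expr0 mulr1; congr (_ + _).
rewrite mulr_sumr; apply: eq_bigr => i _.
by rewrite tnthS exprS mulrCA.
Qed.

Lemma of_digits_rcons n a (mu : n.-tuple kF) :
  of_digits (rcons_tuple mu a) = of_digits mu + varpi ^+ n * teich a.
Proof.
rewrite /Defs.of_digits big_ord_recr /= (tnth_nth 0) /= nth_rcons size_tuple.
rewrite ltnn eqxx mulrC; congr (_ + _); apply: eq_bigr => i _.
by rewrite !(tnth_nth 0) /= nth_rcons size_tuple ltn_ord.
Qed.

Lemma of_digits_integer n (mu : n.-tuple kF) : of_digits mu \in O.
Proof. by apply: rpred_sum => i _; integral. Qed.

Lemma of_digits_exists n y : y \in O ->
  exists (mu : n.-tuple kF) z, z \in O /\ y = of_digits mu + varpi ^+ n * z.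
Proof.
elim: n y => [|n IHn] y yO.
  exists [tuple], y; split=> //; rewrite /Defs.of_digits big_ord0.
  by rewrite expr0 mul1r add0r.
have [y' y'O ->] := red_congr yO (teichO (red y)) (esym (red_teich _)).
have [mu [z [zO ->]]] := IHn y' y'O.
exists (cons_tuple (red y) mu), z; split=> //.
by rewrite of_digits_cons mulrDr addrA exprS mulrA.
Qed.

Lemma of_digits_inj n (mu mu' : n.-tuple kF) z : z \in O ->
  of_digits mu = of_digits mu' + varpi ^+ n * z -> mu = mu'.
Proof.
move=> zO; elim: n mu mu' => [|n IHn] mu mu'.
  by rewrite (tuple0 mu) (tuple0 mu').
case/tupleP: mu => a mu; case/tupleP: mu' => a' mu'.
rewrite -![[tuple of _ :: _]]/(cons_tuple _ _) !of_digits_cons => E.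
have aa' : a = a'.
  have muO := of_digits_integer mu; have mu'O := of_digits_integer mu'.
  move/(congr1 red): E; rewrite exprS -mulrA.
  by rewrite !(redD, redM) ?red_varpi ?red_teich ?mul0r ?addr0 //; integral.
move: E; rewrite aa' exprS -mulrA -addrA -mulrDr => /addrI.
by move=> /(mulfI varpi_neq0) /IHn ->.
Qed.

Section DigitSums.
Variable V : nmodType.

Definition digit_sum n (g : F -> V) : V :=
  \sum_(mu : n.-tuple kF) g (of_digits mu).

Lemma sum_tuple_rcons n (h : n.+1.-tuple kF -> V) :
  \sum_mu h mu = \sum_(mu : n.-tuple kF) \sum_a h (rcons_tuple mu a).
Proof.
rewrite pair_big /= (reindex (fun x : n.-tuple kF * kF => rcons_tuple x.1 x.2)) //.
apply/onW_bij/inj_card_bij.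
  move=> [mu a] [mu' a'] /(congr1 val) /= /rcons_inj[E ->].
  by congr pair; apply: val_inj.
by rewrite card_prod !card_tuple expnS mulnC.
Qed.

Lemma sum_tuple_cons n (h : n.+1.-tuple kF -> V) :
  \sum_mu h mu = \sum_a \sum_(mu : n.-tuple kF) h (cons_tuple a mu).
Proof.
rewrite pair_big /= (reindex (fun x : kF * n.-tuple kF => cons_tuple x.1 x.2)) //.
apply/onW_bij/inj_card_bij.
  by move=> [a mu] [a' mu'] /(congr1 val) [-> E]; congr pair; apply: val_inj.
by rewrite card_prod !card_tuple expnS.
Qed.

Lemma eq_digit_sum n (g h : F -> V) : (forall y, y \in O -> g y = h y) ->
  digit_sum n g = digit_sum n h.
Proof. by move=> gh; apply: eq_bigr => mu _; apply/gh/of_digits_integer. Qed.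

Lemma digit_sum0 g : digit_sum 0 g = g 0.
Proof.
rewrite /digit_sum (big_pred1 [tuple]) => [|mu]; last first.
  by rewrite (tuple0 mu) /= eqxx.
by rewrite /Defs.of_digits big_ord0.
Qed.

Lemma digit_sumSr n g : digit_sum n.+1 g =
  digit_sum n (fun y => \sum_a g (y + varpi ^+ n * teich a)).
Proof.
rewrite /digit_sum sum_tuple_rcons; apply: eq_bigr => mu _.
by apply: eq_bigr => a _; rewrite of_digits_rcons.
Qed.

Lemma digit_sumSl n g : digit_sum n.+1 g =
  \sum_a digit_sum n (fun y => g (teich a + varpi * y)).
Proof.
rewrite /digit_sum sum_tuple_cons; apply: eq_bigr => a _.
by apply: eq_bigr => mu _; rewrite of_digits_cons.
Qed.

(** Modulo [varpi ^+ n] the map [m] is an injection of a finite set into itself,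
    hence a permutation. *)
Lemma digit_sum_perm n (m : F -> F) (h : F -> V) :
    {in O, forall y, m y \in O} ->
    {in O & O, forall y y', (exists2 z, z \in O & m y = m y' + varpi ^+ n * z) ->
      exists2 z, z \in O & y = y' + varpi ^+ n * z} ->
    {in O & O, forall y z, h (y + varpi ^+ n * z) = h y} ->
  digit_sum n (h \o m) = digit_sum n h.
Proof.
move=> mO mI hper.
have [s sE] := fin_all_exists (fun mu : n.-tuple kF =>
  of_digits_exists n (mO _ (of_digits_integer mu))).
have sI : injective s.
  move=> mu mu' Es; have [z [zO Ez]] := sE mu; have [z' [z'O Ez']] := sE mu'.
  have [|||w wO Ew] := mI (of_digits mu) (of_digits mu');
    try exact: of_digits_integer.
    exists (z - z'); first exact: rpredB.
    by rewrite Ez Ez' Es; ring.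
  exact: of_digits_inj wO Ew.
rewrite /digit_sum [RHS](reindex_inj sI); apply: eq_bigr => mu _ /=.
by have [z [zO ->]] := sE mu; rewrite hper // of_digits_integer.
Qed.

End DigitSums.

Lemma gl2M a b c d a' b' c' d' :
    a * d - b * c != 0 -> a' * d' - b' * c' != 0 ->
  (gl2 a b c d * gl2 a' b' c' d')%g =
  gl2 (a * a' + b * c') (a * b' + b * d') (c * a' + d * c') (c * b' + d * d')
  :> GL2 F.
Proof.
move=> D D'; apply: val_inj; rewrite [LHS]gl2_mxM (gl2E D) (gl2E D') mulmx_mx2.
rewrite [RHS]gl2E //.
have -> : (a * a' + b * c') * (c * b' + d * d') -
  (a * b' + b * d') * (c * a' + d * c') =
  (a * d - b * c) * (a' * d' - b' * c') by ring.
exact: mulf_neq0.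
Qed.

Lemma gl2_1 : (1 : GL2 F)%g = gl2 1 0 0 1.
Proof.
by apply: val_inj; rewrite [RHS]gl2E ?mulr1 ?mul0r ?subr0 ?oner_neq0 // -mx2_1.
Qed.

Lemma gl2V a b c d : let D := a * d - b * c in D != 0 ->
  ((gl2 a b c d)^-1)%g = gl2 (d / D) (- b / D) (- c / D) (a / D) :> GL2 F.
Proof.
move=> D D0; rewrite -[LHS]mulg1 -[RHS](mulKg (gl2 a b c d)); congr (_ * _)%g.
have D'E : d / D * (a / D) - - b / D * (- c / D) = D^-1 by rewrite /D; field.
rewrite gl2M // ?D'E ?invr_neq0 // gl2_1.
by congr gl2; rewrite /D; field.
Qed.

Lemma gl2_iwahori a b c d :
    a \in O -> b \in O -> c \in maxideal v -> d \in O ->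
    red a != 0 -> red d != 0 ->
  gl2 a b c d \in iwahori v.
Proof.
move=> aO bO cm dO ra rd; have cO := maxideal_integer cm.
set D := a * d - b * c; have DO : D \in O by integral.
have rD : red D != 0.
  by rewrite redB ?redM ?(red_maxideal cm) ?mulr0 ?subr0 ?mulf_neq0 //; integral.
have VO := unit_inv_integer DO rD; have D0 := red_neq0 rD.
apply/iwahoriP; split; first last; first by rewrite gl2E // mxE.
  rewrite gl2V // gl2E; last first.
    rewrite (_ : _ - _ = D^-1) ?invr_neq0 //; by rewrite /D; field.
  by move=> i j; rewrite mxE; case: ifP => _; case: ifP => _; integral.
by move=> i j; rewrite gl2E // mxE; case: ifP => _; case: ifP => _.
Qed.

Lemma iwahori_gl2 x : x \in iwahori v -> exists a b c d,
  [/\ x = gl2 a b c d, [/\ a \in O, b \in O, c \in maxideal v & d \in O]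
    & red a != 0 /\ red d != 0].
Proof.
move=> /iwahoriP[xO xVO xm]; exists (x 0 0), (x 0 1), (x 1 0), (x 1 1).
have E i j : red (x i 0) * red (x^-1%g 0 j) + red (x i 1) * red (x^-1%g 1 j) =
  (i == j)%:R.
  rewrite -!redM ?xO ?xVO // -redD ?rpredM ?xO ?xVO //.
  have := congr1 (fun g : GL2 F => gl2_mx g i j) (mulgV x).
  rewrite gl2_mxM gl2_mx1 !mxE big_ord_recl big_ord1.
  have -> : lift ord0 ord0 = 1 :> 'I_2 by apply: val_inj.
  by move=> ->; case: (i == j); rewrite ?red1 ?red0.
have r11 : red (x 1 1) != 0.
  apply: contra_eq_neq (E 1 1) => ->.
  by rewrite (red_maxideal xm) !mul0r addr0 eq_sym oner_neq0.
have rV10 : red (x^-1%g 1 0) = 0.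
  have /eqP := E 1 0; rewrite (red_maxideal xm) mul0r add0r.
  by rewrite mulf_eq0 (negPf r11) => /eqP.
have r00 : red (x 0 0) != 0.
  apply: contra_eq_neq (E 0 0) => ->.
  by rewrite rV10 mulr0 mul0r addr0 eq_sym oner_neq0.
split=> //; apply: val_inj; rewrite [RHS]gl2E; first by rewrite /= [LHS]mx2E.
apply: red_neq0; rewrite redB ?redM //; try by integral.
by rewrite (red_maxideal xm) mulr0 subr0 mulf_neq0.
Qed.

Lemma gl2_scalar (c : F) : c != 0 -> gl2_mx (gl2 c 0 0 c) = c%:M.
Proof.
move=> c0; rewrite gl2E ?mul0r ?subr0 ?mulf_neq0 // -[in RHS](mulr1 c).
by rewrite -scale_scalar_mx mx2_1 [RHS]mx2E !mxE /= !mulr0 !mulr1.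
Qed.

Lemma scalar_iwahoriZ c : c != 0 -> gl2 c 0 0 c \in iwahoriZ v.
Proof.
move=> c0; apply/asboolP; exists 1%g, (gl2 c 0 0 c).
rewrite mul1g iwahori_closed1; split=> //.
by apply/asboolP; exists c; apply: gl2_scalar.
Qed.

Lemma iwahori_iwahoriZ x : x \in iwahori v -> x \in iwahoriZ v.
Proof.
by move=> xI; apply/asboolP; exists x, 1%g; rewrite mulg1 xI center_closed1.
Qed.

(** * The relations of the quotient *)

Lemma card_natr0 : #|kF|%:R = 0 :> kF.
Proof.
have E : \sum_(a : kF) a = \sum_(a : kF) (a + 1).
  by rewrite [LHS](reindex_inj (addIr 1)).
move: E; rewrite big_split sumr_const /= => E.
by apply: (addrI (\sum_(a : kF) a)); rewrite -E addr0.
Qed.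

Section Quotient.
Variable k : fieldType.
Variable phi : {rmorphism kF -> k}.
Local Notation tau := (tau v varpi teich k).
Local Notation cls := (@cls F v varpi kF teich k).
Local Notation T12 := (T12 v varpi teich k).
Local Notation act := (@tau_act F v varpi kF teich k).
Local Notation brk := (br v k).
Local Notation vt g := (cls (br v k g)).
Local Notation G := (GL2 F).

Lemma card_natr0k : #|kF|%:R = 0 :> k.
Proof. by rewrite -(rmorph_nat phi) card_natr0 rmorph0. Qed.

Lemma sum_const0 (V : lmodType k) (x : V) : \sum_(a : kF) x = 0.
Proof. by rewrite sumr_const -scaler_nat card_natr0k scale0r. Qed.

Lemma cls_sum (T : finType) (P : pred T) (f : T -> indIZ v k) :
  cls (\sum_(i | P i) f i) = \sum_(i | P i) cls (f i).
Proof. exact: linear_sum. Qed.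

Lemma act_cls g f : act g (cls f) = cls (ind_act g f).
Proof. exact: tau_act_cls hpi hred hteich g f. Qed.

Lemma act_is_linear g : linear (act g).
Proof.
move=> a x y; have [f ->] := clsP x; have [h ->] := clsP y.
by rewrite -linearP !act_cls linearP linearP.
Qed.

Lemma actZ g a x : act g (a *: x) = a *: act g x.
Proof.
pose L := GRing.isLinear.Build k tau tau *:%R (act g) (act_is_linear g).
pose A : {linear tau -> tau} := HB.pack (act g) L.
exact: (linearZ_LR A).
Qed.

Lemma act_sum (T : finType) g (x : T -> tau) :
  act g (\sum_i x i) = \sum_i act g (x i).
Proof.
pose L := GRing.isLinear.Build k tau tau *:%R (act g) (act_is_linear g).
pose A : {linear tau -> tau} := HB.pack (act g) L.
exact: (linear_sum A).
Qed.

Lemma actN g x : act g (- x) = - act g x.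
Proof. by rewrite -!scaleN1r actZ. Qed.

Lemma act_digit_sum n g (x : F -> tau) :
  act g (digit_sum n x) = digit_sum n (fun y => act g (x y)).
Proof. exact: act_sum. Qed.

Lemma act1 x : act 1%g x = x.
Proof. by have [f ->] := clsP x; rewrite act_cls ind_act1. Qed.

Lemma actM g h x : act (g * h)%g x = act g (act h x).
Proof. by have [f ->] := clsP x; rewrite !act_cls ind_actM. Qed.

Lemma act_vt g h : act g (vt h) = vt (g * h)%g.
Proof. by rewrite act_cls; congr (cls _); apply: ind_act_brk. Qed.

Lemma act_scalar c x : c != 0 -> act (gl2 c 0 0 c) x = x.
Proof.
move=> c0; have [f ->] := clsP x; rewrite act_cls; congr (cls _).
have zJ := scalar_iwahoriZ c0; have [fJ _] := indP f.
apply/val_inj/funext => g /=.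
rewrite (_ : _ * g = g * (gl2 c 0 0 c)^-1)%g; first by rewrite fJ ?gpredV.
by apply/center_comm/center_closedV/asboolP; exists c; apply: gl2_scalar.
Qed.

Lemma brk_iwahoriZ g x : x \in iwahoriZ v -> brk (g * x)%g = brk g.
Proof. by move=> xJ; apply/esym/eq_brk; rewrite mulKg. Qed.

Lemma brk_iwahori g x : x \in iwahori v -> brk (g * x)%g = brk g.
Proof. by move=> xI; apply/brk_iwahoriZ/iwahori_iwahoriZ. Qed.

Lemma brk_scalar g c : c != 0 -> brk (g * gl2 c 0 0 c)%g = brk g.
Proof. by move=> c0; apply/brk_iwahoriZ/scalar_iwahoriZ. Qed.

Local Notation flip a := (gl2 (teich a) 1 1 0).

Lemma T12_beta g :
  T12 (brk (g * beta varpi)%g) = \sum_a brk (g * flip a)%g.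
Proof.
have pi0 := varpi_neq0.
rewrite (T12_br k hpi hred hteich) /T12_brk; apply: eq_bigr => a _.
rewrite -[RHS](brk_scalar _ pi0) -!mulgA; congr (brk (_ * _)%g).
rewrite !gl2M ?mul1r ?mul0r ?mulr0 ?subr0 ?sub0r ?oppr_eq0 ?mulf_neq0 ?oner_neq0 //.
by congr gl2; ring.
Qed.

Lemma T12_cls0 f : cls (T12 f) = 0.
Proof.
have <- : cls 0 = 0 by exact: linear0.
apply/cls_eqP/asboolP; exists f, 0; split; first exact: (linear0 T12).
by rewrite subr0 addr0.
Qed.

Lemma T12_ker0 f : T12 f = 0 -> cls f = 0.
Proof.
have <- : cls 0 = 0 by exact: linear0.
move=> f0; apply/cls_eqP/asboolP; exists 0, f; split=> //.
by rewrite (linear0 T12) subr0 add0r.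
Qed.

Lemma sum_flip0 g : \sum_a vt (g * flip a)%g = 0.
Proof.
by rewrite -[RHS](T12_cls0 (brk (g * beta varpi)%g)) T12_beta cls_sum.
Qed.

(** The cosets of the Iwahori subgroup in GL_2(O) are the points of P^1(F_q);
    a matrix goes to the reduction of its first column, and the columns (1, a)
    and (1/a, 1) are proportional. *)
Lemma brk_flip_lower g a : a != 0 ->
  brk (g * gl2 1 0 (teich a) 1)%g = brk (g * flip a^-1%R)%g.
Proof.
move=> a0; have ta0 := teich_neq0 a0.
have aI : gl2 (teich a) 1 0 (- teich a^-1%R) \in iwahori v.
  apply: gl2_iwahori; rewrite ?redN ?red_teich ?oppr_eq0 ?invr_eq0 //; integral.
  exact: val_ge0.
rewrite -[RHS](brk_iwahori _ aI) -mulgA; congr (brk (_ * _)%g).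
rewrite gl2M ?mulr1 ?mulr0 ?mul0r ?sub0r ?subr0 ?oppr_eq0 ?mulf_neq0
  ?oppr_eq0 ?teich_neq0 ?invr_eq0 ?oner_neq0 //.
by congr gl2; rewrite ?teichV; field.
Qed.

(** The sum [all h] of the edges at a vertex does not depend on the edge [h], and
    by [sum_flip0] it is equal to [h] in the quotient. *)
Lemma vt_flip0 g : vt (g * gl2 0 1 1 0)%g = vt g.
Proof.
pose all h := vt h + \sum_a vt (h * flip a)%g.
have allE h : all h = vt h by rewrite /all sum_flip0 addr0.
rewrite -[LHS]allE -[RHS]allE /all [in RHS](bigD1 0) //= [in LHS](bigD1 0) //=.
rewrite teich0 -mulgA gl2M ?mulr0 ?mulr1 ?sub0r ?oppr_eq0 ?oner_neq0 //.
rewrite !(mul0r, mulr0, mulr1, addr0, add0r) -gl2_1 mulg1 addrCA.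
congr (_ + (_ + _)).
rewrite [RHS](reindex_inj invr_inj) /=.
under [RHS]eq_bigl => a do rewrite invr_eq0.
apply: eq_bigr => a a0; congr (cls _); rewrite -brk_flip_lower //; congr brk.
rewrite -mulgA gl2M ?mulr0 ?mulr1 ?sub0r ?oppr_eq0 ?oner_neq0 //.
by congr (_ * _)%g; congr gl2; ring.
Qed.

Lemma flip_congr g a c : c \in O -> red c = a ->
  brk (g * gl2 c 1 1 0)%g = brk (g * flip a)%g.
Proof.
move=> cO ca; have [|z zO cE] := red_congr cO (teichO a).
  by rewrite red_teich.
have I : gl2 1 0 (varpi * z) 1 \in iwahori v.
  apply: gl2_iwahori; rewrite ?red1 ?oner_neq0 //; integral.
  by apply/maxidealP; exists z.
rewrite -[RHS](brk_iwahori _ I) -mulgA gl2M; last first.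
- by rewrite mulr1 mul0r subr0 oner_neq0.
- by rewrite mulr0 mulr1 sub0r oppr_eq0 oner_neq0.
by congr (brk (_ * _)%g); rewrite cE; congr gl2; ring.
Qed.

(** The difference of the two sides lifts to an element of the kernel of
    T_{1,2}. With [S := \sum_a brk (g * flip a)], T_{1,2} sends [brk (g * beta)]
    to [S] and the a-th term on the left to [brk g] plus the [brk] of
    [g * flip (a + b^-1)] for [b != 0]. Summed over [a], this gives
    [q brk g + (q - 1) S = - S]. *)
Lemma sum_neighbours g :
  \sum_a vt (g * gl2 varpi (teich a) 0 1)%g = - vt (g * beta varpi)%g.
Proof.
have pi0 := varpi_neq0.
apply/eqP; rewrite -addr_eq0 -cls_sum -clsD; apply/eqP/T12_ker0.
have E a : T12 (brk (g * gl2 varpi (teich a) 0 1)%g) =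
    brk g + \sum_(b | b != 0) brk (g * flip (a + b^-1)%R)%g.
  have aI : gl2 1 (teich a) 0 1 \in iwahori v.
    apply: gl2_iwahori; rewrite ?red1 ?oner_neq0 //; integral.
    exact: val_ge0.
  rewrite (T12_br k hpi hred hteich) /T12_brk (bigD1 0) //=; congr (_ + _).
    rewrite -[RHS](brk_iwahori _ aI) -[RHS](brk_scalar _ pi0) -!mulgA.
    congr (brk (_ * _)%g); rewrite teich0.
    by rewrite !gl2M ?(mul1r, mul0r, mulr1, mulr0, subr0) ?mulf_neq0 ?oner_neq0.
  apply: eq_bigr => b b0; have tb0 := teich_neq0 b0.
  have bI : gl2 (teich b) 1 0 (- teich b^-1%R) \in iwahori v.
    apply: gl2_iwahori; rewrite ?redN ?red_teich ?oppr_eq0 ?invr_eq0 //; integral.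
    exact: val_ge0.
  have <- : brk (g * gl2 (teich a + teich b^-1%R) 1 1 0)%g =
      brk (g * flip (a + b^-1)%R)%g.
    by apply: flip_congr; [integral | rewrite redD ?red_teich //; integral].
  rewrite -[RHS](brk_iwahori _ bI) -[RHS](brk_scalar _ pi0) -!mulgA.
  congr (brk (_ * _)%g).
  have tV0 : teich b^-1 != 0 by rewrite teichV invr_eq0.
  have D1 : teich b * - teich b^-1 - 1 * 0 != 0.
    by rewrite mul1r subr0 mulf_neq0 ?oppr_eq0.
  have D2 : varpi * varpi - 0 * 0 != 0 by rewrite mul0r subr0 mulf_neq0.
  rewrite (gl2M D1 D2) !gl2M ?(mul1r, mul0r, mulr1, mulr0, subr0, sub0r,
    addr0, add0r, oppr_eq0) ?mulf_neq0 ?oner_neq0 ?oppr_eq0 //.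
  by congr gl2; rewrite ?teichV; field.
have T12D (h h' : indIZ v k) : T12 (h + h') = T12 h + T12 h' by exact: linearD.
have T12s (h : kF -> indIZ v k) : T12 (\sum_a h a) = \sum_a T12 (h a).
  exact: linear_sum.
rewrite T12D T12s T12_beta /=.
under eq_bigr => a _ do rewrite E.
have s0 (h : indIZ v k) : \sum_(a : kF) h = 0 by exact: sum_const0.
rewrite big_split /= s0 add0r exchange_big /=.
have E' b : \sum_a brk (g * flip (a + b^-1)%R)%g = \sum_a brk (g * flip a)%g.
  by rewrite [RHS](reindex_inj (addIr b^-1)).
under eq_bigr => b _ do rewrite E'.
by have := s0 (\sum_a brk (g * flip a)%g); rewrite (bigD1 0) //= addrC.
Qed.


(** * Vertices of the tree *)

(** The vertex (varpi^n y; 0 1) of the tree, represented by one of its edges. *)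
Definition vtx n y : tau := vt (gl2 (varpi ^+ n) y 0 1).

Lemma varpiX_neq0 n : varpi ^+ n != 0.
Proof. by rewrite expf_neq0 // varpi_neq0. Qed.

Lemma vt_iwahori g x : x \in iwahori v -> vt (g * x)%g = vt g.
Proof. by move=> xI; rewrite brk_iwahori. Qed.

Lemma vtx_congr n y z : z \in O -> vtx n (y + varpi ^+ n * z) = vtx n y.
Proof.
move=> zO; have I : gl2 1 z 0 1 \in iwahori v.
  by apply: gl2_iwahori; rewrite ?red1 ?oner_neq0 ?integers1 //; exact: val_ge0.
rewrite /vtx -[RHS](vt_iwahori _ I); congr (cls (brk _)).
rewrite gl2M ?(mulr1, mul0r, mulr0, subr0) ?oner_neq0 ?varpiX_neq0 //.
by congr gl2; ring.
Qed.

(** The remaining neighbour of the vertex [vtx n.+1 y] is its parent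
    [vtx n y]. *)
Lemma sum_vtx n y :
  \sum_a vtx n.+2 (y + varpi ^+ n.+1 * teich a) = - vtx n y.
Proof.
have pi0 := varpi_neq0; have pin0 i := varpiX_neq0 i.
transitivity (- vt (gl2 (varpi ^+ n.+1) y 0 1 * beta varpi)%g).
  rewrite -sum_neighbours; apply: eq_bigr => a _; congr (cls (brk _)).
  rewrite gl2M ?(mulr1, mul0r, mulr0, subr0) ?oner_neq0 //.
  by congr gl2; rewrite -?exprSr; ring.
congr (- _); rewrite /vtx -[RHS]vt_flip0; congr cls.
rewrite -[RHS](brk_scalar _ pi0); congr brk.
rewrite !gl2M ?(mul1r, mulr1, mul0r, mulr0, subr0, sub0r, add0r, addr0,
  oppr_eq0) ?mulf_neq0 ?oner_neq0 //.
by congr gl2; rewrite -?exprSr; ring.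
Qed.

Lemma sum_vtx1 : \sum_a vtx 1 (teich a) = - vt (beta varpi).
Proof.
rewrite -(mul1g (beta varpi)) -sum_neighbours; apply: eq_bigr => a _.
by rewrite mul1g /vtx expr1.
Qed.

Lemma act_shift n y a :
  act (gl2 varpi (teich a) 0 1) (vtx n y) = vtx n.+1 (teich a + varpi * y).
Proof.
rewrite act_vt; congr (cls (brk _)).
rewrite gl2M ?(mulr1, mul0r, mulr0, subr0) ?oner_neq0 ?varpi_neq0 ?varpiX_neq0 //.
by congr gl2; rewrite -?exprS; ring.
Qed.


(** * The vectors s_n *)

Lemma teichD_congr a z : z \in O ->
  exists2 w, w \in O & teich a + z = teich (a + red z) + varpi * w.
Proof.
move=> zO; apply: red_congr; try by integral.
by rewrite redD ?red_teich //; integral.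
Qed.

Definition last_digit_sum n y : tau :=
  \sum_a phi a *: vtx n.+1 (y + varpi ^+ n * teich a).

(** With [phi] the p^l-th power, this is the class of s_{n+1}: the sum over the
    last digit, the one that carries the weight, is taken first. *)
Definition s_tau n : tau := digit_sum n (last_digit_sum n).

(** Translating the digit [a] by [red z] changes its weight by [phi (red z)], and
    the unweighted sum over [a] is minus a vertex by [sum_vtx]. *)
Lemma last_digit_sumD n y z : z \in O ->
  last_digit_sum n.+1 (y + varpi ^+ n.+1 * z) =
  last_digit_sum n.+1 y + phi (red z) *: vtx n y.
Proof.
move=> zO; have sv : - vtx n y =
    \sum_a vtx n.+2 (y + varpi ^+ n.+1 * teich (a + red z)).
  by rewrite -sum_vtx (reindex_inj (addIr (red z))).
apply/eqP; rewrite -subr_eq -scalerN sv scaler_sumr -big_split; apply/eqP.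
rewrite /last_digit_sum [RHS](reindex_inj (addIr (red z))).
apply: eq_bigr => a _ /=.
have [w wO E] := teichD_congr a zO.
have -> : y + varpi ^+ n.+1 * z + varpi ^+ n.+1 * teich a =
    y + varpi ^+ n.+1 * teich (a + red z) + varpi ^+ n.+2 * w.
  by rewrite -!addrA -mulrDr [z + _]addrC E [varpi ^+ n.+2]exprSr; ring.
by rewrite vtx_congr // rmorphD scalerDl.
Qed.

Definition last_two_digits_sum n y : tau :=
  \sum_a last_digit_sum n.+1 (y + varpi ^+ n * teich a).

(** By [last_digit_sumD] each error [varpi ^+ n.+1 * u a] contributes
    [phi (red (u a))] times the vertex [vtx n y], the same for all [a], and
    [phi] is additive. *)
Lemma last_two_digits_sumE n y (r : kF -> kF) (u : kF -> F) :
    injective r -> (forall a, u a \in O) -> \sum_a red (u a) = 0 ->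
  \sum_a last_digit_sum n.+1
           (y + varpi ^+ n * teich (r a) + varpi ^+ n.+1 * u a) =
  last_two_digits_sum n y.
Proof.
move=> rI uO u0.
have E a : last_digit_sum n.+1
      (y + varpi ^+ n * teich (r a) + varpi ^+ n.+1 * u a) =
    last_digit_sum n.+1 (y + varpi ^+ n * teich (r a)) + phi (red (u a)) *: vtx n y.
  by rewrite last_digit_sumD // vtx_congr //; integral.
rewrite (eq_bigr _ (fun a _ => E a)) big_split -scaler_suml -rmorph_sum /= u0.
by rewrite rmorph0 scale0r addr0 /last_two_digits_sum [RHS](reindex_inj rI).
Qed.

Lemma digit_sum_last_digits n :
  digit_sum n.+1 (last_digit_sum n.+1) = digit_sum n (last_two_digits_sum n).
Proof. exact: digit_sumSr. Qed.

(** This is [1 < e * f], the valuation of [q] being [e * f]. *)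
Hypothesis card_deep : exists2 z, z \in O & #|kF|%:R = varpi ^+ 2 * z.
Hypothesis card_gt3 : (3 < #|kF|)%N.

(** The carries [w a] defined by
    [teich a + z = teich (a + red z) + varpi * w a] add up to [q z / varpi],
    because translation by [red z] permutes F_q; this is divisible by [varpi]. *)
Lemma last_two_digits_sum_congr n y z : z \in O ->
  last_two_digits_sum n (y + varpi ^+ n * z) = last_two_digits_sum n y.
Proof.
move=> zO; have [w wO wE] := fin_all_exists2 (fun a => teichD_congr a zO).
rewrite -[RHS](@last_two_digits_sumE n y _ w (addIr (red z)) wO).
  apply: eq_bigr => a _; congr last_digit_sum.
  by rewrite -!addrA -mulrDr [z + _]addrC wE [varpi ^+ n.+1]exprSr; ring.
rewrite -red_sum //; have [q' q'O qE] := card_deep.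
have -> : \sum_a w a = varpi * (q' * z).
  apply: (mulfI varpi_neq0); rewrite !mulrA -[varpi * varpi]/(varpi ^+ 2) -qE.
  rewrite mulr_sumr; transitivity (\sum_a (teich a + z - teich (a + red z))).
    by apply: eq_bigr => a _; rewrite wE addrAC subrr add0r.
  rewrite sumrB big_split /= [X in X + _ - _](reindex_inj (addIr (red z))) /=.
  by rewrite addrAC subrr add0r sumr_const mulr_natl.
by rewrite redM ?red_varpi ?mul0r //; integral.
Qed.

Lemma sum_eigen0 (T : finType) (R : fieldType) (f : T -> R) (r : T -> T) c :
  injective r -> c != 1 -> (forall i, f (r i) = c * f i) -> \sum_i f i = 0.
Proof.
move=> rI c1 fr; have E : \sum_i f i = c * \sum_i f i.
  by rewrite {1}(reindex_inj rI) mulr_sumr; apply: eq_bigr => i _.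
apply/eqP; move/eqP: E; rewrite -subr_eq0 -{1}[\sum_i f i]mul1r -mulrBl mulf_eq0.
by rewrite subr_eq0 eq_sym (negPf c1).
Qed.

Lemma exists_sqr_neq1 : exists2 a : kF, a != 0 & a ^+ 2 != 1.
Proof.
have [a] : exists a : kF, a \notin [set 0; 1; -1].
  apply/existsP; rewrite -negb_forall; apply: contraL card_gt3 => /forallP A.
  rewrite -leqNgt -cardsT; apply: (@leq_trans #|[set 0; 1; -1 : kF]|).
    by apply/subset_leq_card/fintype.subsetP => x _; have /negPn := A x.
  by rewrite finset.setUC cardsU1 cards2; case: (_ \notin _); case: (_ != _).
rewrite !inE !negb_or -andbA => /and3P[a0 a1 aN1]; exists a => //.
by rewrite sqrf_eq1 negb_or a1.
Qed.

Lemma sum_sqr0 : \sum_(a : kF) a ^+ 2 = 0.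
Proof.
have [b b0 b1] := exists_sqr_neq1.
by apply: (sum_eigen0 (mulfI b0) b1) => a; rewrite exprMn.
Qed.

Lemma sum_id0 : \sum_(a : kF) a = 0.
Proof.
have [b b0 b1] := exists_sqr_neq1.
apply: (sum_eigen0 (mulfI b0) (c := b)) => //.
by apply: contra_neq b1 => ->; rewrite expr1n.
Qed.


(** * The action of the Iwahori subgroup *)

Definition mobius a b c d y : F := (a * y + b) / (c * y + d).

Section IwahoriAction.
Variables a b c d : F.
Hypotheses (aO : a \in O) (bO : b \in O) (cm : c \in maxideal v) (dO : d \in O).
Hypotheses (ra : red a != 0) (rd : red d != 0).
Local Notation m := (mobius a b c d).
Local Notation D := (a * d - b * c).

Let cO : c \in O. Proof. exact: maxideal_integer. Qed.

Lemma red_denominator y : y \in O -> red (c * y + d) = red d.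
Proof.
move=> yO; rewrite redD ?redM //; try by integral.
by rewrite (red_maxideal cm) mul0r add0r.
Qed.

Lemma denominator_integer y : y \in O -> c * y + d \in O.
Proof. by move=> yO; integral. Qed.

Lemma denominatorV_integer y : y \in O -> (c * y + d)^-1 \in O.
Proof.
by move=> yO; apply: unit_inv_integer; rewrite ?denominator_integer ?red_denominator.
Qed.

Lemma denominator_neq0 y : y \in O -> c * y + d != 0.
Proof. by move=> yO; apply: red_neq0; rewrite red_denominator. Qed.

Lemma mobius_integer y : y \in O -> m y \in O.
Proof.
by move=> yO; have := denominatorV_integer yO; rewrite /mobius => ?; integral.
Qed.

Lemma red_det : red D = red a * red d.
Proof.
by rewrite redB ?redM ?(red_maxideal cm) ?mulr0 ?subr0 //; integral.
Qed.

Lemma det_neq0 : D != 0.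
Proof. by apply: red_neq0; rewrite red_det mulf_neq0. Qed.

Lemma detV_integer : D^-1 \in O.
Proof. by apply: unit_inv_integer; rewrite ?red_det ?mulf_neq0 //; integral. Qed.

Lemma mobiusD y h : y \in O -> h \in O ->
  m (y + h) = m y + h * (D / ((c * y + d) * (c * (y + h) + d))).
Proof.
move=> yO hO; have D1 := denominator_neq0 yO.
have D2 := denominator_neq0 (rpredD yO hO).
by rewrite /mobius; field; rewrite D1 D2.
Qed.

Lemma mobius_slope y y' : y \in O -> y' \in O ->
  let s := D / ((c * y + d) * (c * y' + d)) in
  s \in O /\ red s = red a / red d.
Proof.
move=> yO y'O s; have V1 := denominatorV_integer yO.
have V2 := denominatorV_integer y'O.
split; first by rewrite /s invfM; integral.
rewrite /s invfM !redM ?redV ?red_denominator ?red_det ?denominator_integer //;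
  try by integral.
by field; rewrite rd.
Qed.

Lemma mobius_inj n y y' z : y \in O -> y' \in O -> z \in O ->
    m y = m y' + varpi ^+ n * z ->
  exists2 z, z \in O & y = y' + varpi ^+ n * z.
Proof.
move=> yO y'O zO E; have DV := detV_integer.
have := denominator_integer yO; have := denominator_integer y'O => t'O tO.
exists (z * ((c * y + d) * (c * y' + d)) / D); first by integral.
have := mobiusD y'O (rpredB yO y'O); rewrite addrC subrK E => /addrI Ez.
rewrite 2!mulrA Ez.
have := denominator_neq0 yO; have := denominator_neq0 y'O => t'0 t0.
by have := det_neq0 => D0; field; rewrite D0 t0 t'0.
Qed.

Lemma act_vtx n y : y \in O ->
  act (gl2 a b c d) (vtx n y) = vtx n (m y).
Proof.
move=> yO; have myO := mobius_integer yO; have t0 := denominator_neq0 yO.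
have tVO := denominatorV_integer yO.
have I : gl2 (a - m y * c) 0 (c * varpi ^+ n) (c * y + d) \in iwahori v.
  apply: gl2_iwahori; rewrite ?red_denominator ?redB ?redM ?(red_maxideal cm);
    try by integral.
  - by apply: maxidealMl => //; integral.
  - by rewrite mulr0 subr0.
rewrite /vtx act_vt -[RHS](vt_iwahori _ I); congr (cls (brk _)).
have D1 : (a - m y * c) * (c * y + d) - 0 * (c * varpi ^+ n) != 0.
  rewrite mul0r subr0 mulrBl mulrAC /mobius divfK //.
  by rewrite (_ : _ - _ = D); [exact: det_neq0 | ring].
rewrite !gl2M ?det_neq0 ?mulr1 ?mulr0 ?subr0 ?varpiX_neq0 //.
by congr gl2; rewrite /mobius; field.
Qed.

Local Notation alpha := (red a / red d).

Let alpha_neq0 : alpha != 0. Proof. by rewrite mulf_neq0 ?invr_eq0. Qed.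

Lemma act_last_digit_sum n y : y \in O ->
  act (gl2 a b c d) (last_digit_sum n y) =
  (phi alpha)^-1 *: last_digit_sum n (m y).
Proof.
move=> yO; rewrite act_sum [in RHS]/last_digit_sum.
rewrite [X in _ = _ *: X](reindex_inj (mulfI alpha_neq0)) scaler_sumr.
apply: eq_bigr => l _; rewrite actZ.
have hO : varpi ^+ n * teich l \in O by integral.
have yhO := rpredD yO hO.
rewrite act_vtx // mobiusD //.
have [] := mobius_slope yO yhO; set k' := D / _ => kO kE.
have [|||w wO E] := @red_congr (teich l * k') (teich (alpha * l)); try by integral.
  by rewrite redM ?red_teich ?kE 1?mulrC //; integral.
rewrite -mulrA E mulrDr addrA [varpi ^+ n * (varpi * w)]mulrA -exprSr vtx_congr //.
by rewrite [phi (_ * l)]rmorphM scalerA mulrA mulVf ?mul1r // fmorph_eq0.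
Qed.

(** With [h := varpi ^+ n * teich l], the expansion of [m (y + h)] is
    [m y + varpi ^+ n * teich (alpha * l)] up to an error [varpi ^+ n.+1 * u l]
    where [u l] reduces to a combination of [l] and [l ^+ 2]. The sums of both
    over F_q vanish. *)
Lemma last_two_digits_sum_mobius n y : y \in O ->
  \sum_l last_digit_sum n.+1 (m (y + varpi ^+ n * teich l)) =
  last_two_digits_sum n (m y).
Proof.
move=> yO; have /maxidealP[c' c'O cE] := cm.
have [kO kE] := mobius_slope yO yO.
(* The derivative of [m] at [y], congruent to [teich alpha]. *)
set k0 := D / _ in kO kE.
have [|w wO wE] := red_congr kO (teichO alpha); first by rewrite red_teich.
have hO l : varpi ^+ n * teich l \in O by integral.
pose den l := c * (y + varpi ^+ n * teich l) + d.
have denVO l : (den l)^-1 \in O.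
  exact: denominatorV_integer (rpredD yO (hO l)).
have kcO : k0 * c' * varpi ^+ n \in O by integral.
pose u l := teich l * w - teich l ^+ 2 * (k0 * c' * varpi ^+ n / den l).
have uO l : u l \in O by integral.
rewrite -[RHS](@last_two_digits_sumE n (m y) _ u (mulfI alpha_neq0) uO).
  apply: eq_bigr => l _; congr last_digit_sum; rewrite mobiusD //.
  have t0 := denominator_neq0 yO.
  have d0 : den l != 0 := denominator_neq0 (rpredD yO (hO l)).
  have -> : D / ((c * y + d) * den l) =
      teich alpha + varpi * w - k0 * c' * varpi * (varpi ^+ n * teich l) / den l.
    have -> : k0 * c' * varpi = k0 * c by rewrite cE; ring.
    by rewrite -wE /k0; move: d0; rewrite /den => d0; field; rewrite d0 t0.
  by rewrite [teich (_ * l)](teichM hteich) /u [varpi ^+ n.+1]exprSr; ring.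
have E l : red (u l) = l * red w - l ^+ 2 * (red (k0 * c' * varpi ^+ n) / red d).
  have dE : red (den l) = red d by apply/red_denominator/rpredD.
  have dO' : den l \in O by apply/denominator_integer/rpredD.
  rewrite /u; move: (k0 * c' * varpi ^+ n) kcO => K KO.
  have VO := denVO l.
  by rewrite !expr2 redB ?redM ?redV ?dE ?red_teich //; integral.
rewrite (eq_bigr _ (fun l _ => E l)) sumrB -!mulr_suml sum_id0 sum_sqr0.
by rewrite !mul0r subrr.
Qed.

(** For [n = 0] the weighted digit is the only one, and a translation by a unit
    [b / d] would change s_1 by a multiple of a vertex; hence the condition. *)
Lemma act_s_tau n : (n == 0)%N ==> (b \in maxideal v) ->
  act (gl2 a b c d) (s_tau n) = (phi alpha)^-1 *: s_tau n.
Proof.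
case: n => [/= bm|n _].
  rewrite /s_tau !digit_sum0 act_last_digit_sum ?rpred0 //; congr (_ *: _).
  have /maxidealP[b' b'O bE] := bm.
  apply: eq_bigr => l _; congr (_ *: _).
  have zO : b' / d \in O by have dVO := unit_inv_integer dO rd; integral.
  rewrite -[RHS](vtx_congr _ _ zO); congr vtx.
  by rewrite /mobius bE !mulr0 !add0r expr1 mulrA addrC.
rewrite /s_tau act_digit_sum (eq_digit_sum _ (@act_last_digit_sum n.+1)).
rewrite [LHS]/digit_sum -scaler_sumr; congr (_ *: _).
rewrite -[LHS]/(digit_sum n.+1 (fun y => last_digit_sum n.+1 (m y))).
rewrite digit_sumSr digit_sum_last_digits.
rewrite (eq_digit_sum _ (@last_two_digits_sum_mobius n)).
apply: (digit_sum_perm (m := m)).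
- by move=> y yO; apply: mobius_integer.
- by move=> y y' yO y'O [z zO E]; apply: (mobius_inj yO y'O zO E).
- by move=> y z _ zO; apply: last_two_digits_sum_congr.
Qed.

End IwahoriAction.

(** * The Hecke operators *)

Local Notation bt := (beta varpi).
Local Notation ns := (n_s F).
Local Notation unip := (unip teich).

Lemma beta_conj a b c d : a * d - b * c != 0 ->
  (gl2 a b c d * bt = bt * gl2 d (c / varpi) (b * varpi) a)%g.
Proof.
have pi0 := varpi_neq0 => D0; rewrite !gl2M ?mulr0 ?mul1r ?sub0r ?oppr_eq0 //.
  by congr gl2; field.
by rewrite (_ : _ - _ = a * d - b * c) //; field.
Qed.

Lemma beta_sqr : (bt * bt)%g = gl2 varpi 0 0 varpi.
Proof.
rewrite gl2M ?mulr0 ?mul1r ?sub0r ?oppr_eq0 ?varpi_neq0 //.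
by congr gl2; ring.
Qed.

Lemma act_betaK x : act bt (act bt x) = x.
Proof. by rewrite -actM beta_sqr act_scalar ?varpi_neq0. Qed.

Lemma act_betaV x : act bt^-1%g x = act bt x.
Proof. by rewrite -{1}[x]act_betaK -actM mulVg act1. Qed.

Section IwahoriElement.
Variables a b c d : F.
Hypotheses (aO : a \in O) (bO : b \in O) (cm : c \in maxideal v) (dO : d \in O).
Hypotheses (ra : red a != 0) (rd : red d != 0).

Let D0 : a * d - b * c != 0.
Proof.
apply: red_neq0; have cO := maxideal_integer cm.
rewrite redB ?redM ?(red_maxideal cm) ?mulr0 ?subr0 ?mulf_neq0 //; integral.
Qed.

Let bpi : b * varpi \in maxideal v.
Proof. by rewrite mulrC; apply/maxidealMl/bO/varpi_maxideal. Qed.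

Lemma act_vt1 : act (gl2 a b c d) (vt 1%g) = vt 1%g.
Proof. by rewrite act_vt mulg1 -[gl2 a b c d]mul1g vt_iwahori // gl2_iwahori. Qed.

Lemma act_vt_beta : act (gl2 a b c d) (vt bt) = vt bt.
Proof.
rewrite act_vt beta_conj // vt_iwahori // gl2_iwahori //.
exact: (maxideal_divpi hpi).
Qed.

Lemma act_beta_s_tau n : (n == 0)%N ==> (c / varpi \in maxideal v) ->
  act (gl2 a b c d) (act bt (s_tau n)) =
  (phi (red d / red a))^-1 *: act bt (s_tau n).
Proof.
move=> c'm; rewrite -actM beta_conj // actM act_s_tau ?actZ //.
exact: (maxideal_divpi hpi).
Qed.

End IwahoriElement.

Lemma unip0 : unip 0 = 1%g. Proof. by rewrite /Defs.unip teich0 -gl2_1. Qed.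

Lemma n_sVE : (ns^-1)%g = gl2 0 1 (-1) 0.
Proof.
have D1 : 0 * 0 - -1 * 1 = 1 :> F by ring.
by rewrite /n_s gl2V D1 ?oner_neq0 // !divr1 ?oppr0 ?opprK.
Qed.

Lemma unip_ns_beta a :
  (unip a * ns^-1 * bt = gl2 varpi (teich a) 0 1 * gl2 1 0 0 (-1))%g.
Proof.
have pi0 := varpi_neq0.
by rewrite n_sVE -mulgA !gl2M ?(mul1r, mulr1, mul0r, mulr0, mulrN1, subr0, sub0r,
  add0r, addr0, oppr_eq0, opprK) ?mulf_neq0 ?oner_neq0 ?oppr_eq0 ?oner_neq0.
Qed.

Lemma ns_vt1 : hecke_ns teich act (vt 1%g) = 0.
Proof.
rewrite /hecke_ns -[RHS](sum_const0 (vt 1%g)); apply: eq_bigr => a _.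
have dI : gl2 (-1) 0 0 1 \in iwahori v.
  by apply: gl2_iwahori; rewrite ?redN ?red1 ?oppr_eq0 ?oner_neq0 ?maxideal0 //;
    integral.
have uI : unip a \in iwahori v.
  by apply: gl2_iwahori; rewrite ?red1 ?oner_neq0 //; integral; exact: val_ge0.
rewrite act_vt mulg1 -[RHS](vt_iwahori _ uI) mul1g -[RHS]vt_flip0.
rewrite -[RHS](vt_iwahori _ dI) -mulgA; congr (cls (brk (_ * _)%g)).
rewrite n_sVE gl2M ?(mul0r, mulr0, mulr1, subr0, sub0r, oppr_eq0) ?oner_neq0 //.
by congr gl2; ring.
Qed.

Lemma ns_vt_beta : hecke_ns teich act (vt bt) = - vt bt.
Proof.
rewrite /hecke_ns -sum_vtx1; apply: eq_bigr => a _.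
have dI : gl2 1 0 0 (-1) \in iwahori v.
  by apply: gl2_iwahori; rewrite ?redN ?red1 ?oppr_eq0 ?oner_neq0 ?maxideal0 //;
    integral.
by rewrite act_vt unip_ns_beta vt_iwahori // /vtx expr1.
Qed.

Lemma act_shift_s_tau n :
  \sum_a act (gl2 varpi (teich a) 0 1) (s_tau n) = s_tau n.+1.
Proof.
rewrite [RHS]digit_sumSl; apply: eq_bigr => a _; rewrite act_digit_sum.
apply: eq_bigr => mu _; rewrite act_sum; apply: eq_bigr => l _.
rewrite actZ act_shift; congr (_ *: vtx _ _).
by rewrite exprS; ring.
Qed.

Lemma ns_beta_s_tau n : hecke_ns teich act (act bt (s_tau n)) = - s_tau n.+1.
Proof.
rewrite -act_shift_s_tau -sumrN; apply: eq_bigr => a _.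
rewrite -actM unip_ns_beta actM -actN; congr (act _ _).
rewrite act_s_tau ?redN ?red1 ?oppr_eq0 ?oner_neq0 ?rpredN ?integers1 ?rpred0 //;
  try exact: val_ge0; last by apply/implyP => _; apply: val_ge0.
by rewrite invrN invr1 mulrN1 rmorphN rmorph1 invrN invr1 scaleN1r.
Qed.

(** The Bruhat decomposition of a lower unipotent matrix in the big cell. *)
Lemma ns_unip_ns a : a != 0 -> (ns^-1 * unip a * ns^-1)%g =
  (gl2 1 (- (teich a)^-1) 0 1 * ns^-1 * (gl2 (teich a) 0 0 (teich a)^-1 *
    (gl2 1 (- (teich a)^-1) 0 1 * gl2 (-1) 0 0 (-1))))%g.
Proof.
move=> a0; have t0 := teich_neq0 a0.
rewrite n_sVE !gl2M ?(mul1r, mulr1, mul0r, mulr0, subr0, sub0r, add0r,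
  addr0, oppr_eq0, opprK) ?mulfV ?oner_neq0 //.
  by congr gl2; field.
all: by rewrite !mulf_neq0 ?oppr_eq0 ?invr_eq0 ?oner_neq0.
Qed.

(** As [s_tau n.+1] is minus the image of [Y := beta s] under T_{n_s}, the claim
    is about the square of T_{n_s}, that is, about the double sum over [a] and
    [b] of the images of [Y] under [unip a * ns^-1 * unip b * ns^-1]. The terms
    with [b = 0] are equal to [Y], and there are [q] of them. For [b != 0] the
    decomposition [ns_unip_ns] makes the sum over [a] equal to
    [- phi (b ^+ 2) *: s_tau n.+1], the torus element acting on [Y] by
    [phi (b ^+ 2)]. The sum of the squares [b ^+ 2] is zero. *)
Lemma ns_s_tau n : hecke_ns teich act (s_tau n.+1) = 0.
Proof.
pose Y := act bt (s_tau n).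
have upY y : y \in O -> act (gl2 1 y 0 1) Y = Y.
  move=> yO; rewrite act_beta_s_tau ?red1 ?oner_neq0 ?integers1 ?rpred0 ?mul0r
    ?maxideal0 ?implybT //.
  by rewrite divff ?oner_neq0 // rmorph1 invr1 scale1r.
have N0 : -1 != 0 :> F by rewrite oppr_eq0 oner_neq0.
have E0 a : act (unip a * ns^-1 * unip 0 * ns^-1)%g Y = Y.
  have NN : (ns^-1 * ns^-1)%g = gl2 (-1) 0 0 (-1).
    rewrite n_sVE gl2M ?(mul0r, mulr0, mulr1, mulrN1, subr0, sub0r, opprK)
      ?oner_neq0 //.
    by congr gl2; ring.
  by rewrite unip0 mulg1 -mulgA NN actM act_scalar // upY ?teichO.
have E a b : b != 0 -> act (unip a * ns^-1 * unip b * ns^-1)%g Y =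
    phi (b ^+ 2) *: act (gl2 1 (- (teich b)^-1) 0 1) (act (unip a * ns^-1)%g Y).
  move=> b0; have t0 := teich_neq0 b0.
  have VO : (teich b)^-1 \in O by rewrite -teichV teichO.
  have comm : (unip a * gl2 1 (- (teich b)^-1) 0 1 =
      gl2 1 (- (teich b)^-1) 0 1 * unip a)%g.
    by rewrite !gl2M ?mulr1 ?mulr0 ?subr0 ?oner_neq0 //; congr gl2; ring.
  set A := gl2 1 _ 0 1 in comm *.
  have -> : (unip a * ns^-1 * unip b * ns^-1)%g = (A * (unip a * ns^-1) *
      (gl2 (teich b) 0 0 (teich b)^-1 * (A * gl2 (-1) 0 0 (-1))))%g.
    by rewrite -2!(mulgA (unip a)) ns_unip_ns // -/A !mulgA comm.
  rewrite !actM act_scalar // upY ?rpredN //.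
  rewrite [in X in act _ (act _ X)]/Y act_beta_s_tau ?mul0r ?maxideal0
    ?implybT ?teichO ?rpred0 //; last first.
  - by rewrite -teichV red_teich invr_eq0.
  - by rewrite red_teich.
  by rewrite -teichV !red_teich -invfM -expr2 fmorphV invrK !actZ.
have sE : s_tau n.+1 = - hecke_ns teich act Y by rewrite ns_beta_s_tau opprK.
have up_s y : y \in O -> act (gl2 1 y 0 1) (s_tau n.+1) = s_tau n.+1.
  move=> yO; rewrite act_s_tau ?red1 ?oner_neq0 ?integers1 ?maxideal0 //.
  by rewrite divff ?oner_neq0 // rmorph1 invr1 scale1r.
rewrite /hecke_ns.
have E1 a : act (unip a * ns^-1)%g (s_tau n.+1) =
    - \sum_b act (unip a * ns^-1 * unip b * ns^-1)%g Y.
  rewrite {1}sE actN act_sum; congr (- _); apply: eq_bigr => b _.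
  by rewrite -actM !mulgA.
rewrite (eq_bigr _ (fun a _ => E1 a)) sumrN exchange_big /=.
have E2 b : \sum_a act (unip a * ns^-1 * unip b * ns^-1)%g Y =
    - (phi (b ^+ 2) *: s_tau n.+1).
  have [->|b0] := eqVneq b 0.
    rewrite expr0n rmorph0 scale0r oppr0 -[RHS](sum_const0 Y).
    by apply: eq_bigr => a _; rewrite E0.
  rewrite (eq_bigr _ (fun a _ => E a b b0)) -scaler_sumr -act_sum.
  rewrite -/(hecke_ns teich act Y) -[hecke_ns _ _ Y]opprK -sE actN scalerN up_s //.
  by rewrite rpredN -teichV teichO.
rewrite (eq_bigr _ (fun b _ => E2 b)) sumrN opprK -scaler_suml -rmorph_sum.
by rewrite sum_sqr0 rmorph0 scale0r.
Qed.

Lemma propiwahori_gl2 x : x \in propiwahori v -> exists a b c d,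
  [/\ x = gl2 a b c d, [/\ a \in O, b \in O, c \in maxideal v & d \in O]
    & red a = 1 /\ red d = 1].
Proof.
move=> /andP[/iwahori_gl2 [a [b [c [d [xE [aO bO cm dO] [ra rd]]]]]] /forallP x1].
have D0 : a * d - b * c != 0.
  apply: red_neq0; have cO := maxideal_integer cm.
  by rewrite redB ?redM ?(red_maxideal cm) ?mulr0 ?subr0 ?mulf_neq0 //; integral.
exists a, b, c, d; split=> //.
have red_eq1 y : y \in O -> y - 1 \in maxideal v -> red y = 1.
  move=> yO /red_maxideal /eqP; rewrite redB ?red1 ?integers1 //.
  by rewrite subr_eq0 => /eqP.
have := x1 0; have := x1 1; rewrite xE gl2E // !mxE /= => d1 a1.
by split; apply: red_eq1.
Qed.

(** The vector [x] spans a line on which the Iwahori subgroup acts through its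
    quotient by the pro-p-Iwahori subgroup, the torus [H]. *)
Definition iwahori_eigen (chi : kF -> kF -> k) (x : tau) :=
  forall a b c d, a \in O -> b \in O -> c \in maxideal v -> d \in O ->
    red a != 0 -> red d != 0 ->
  act (gl2 a b c d) x = chi (red a) (red d) *: x.

Lemma eigen_invariant chi x : iwahori_eigen chi x -> chi 1 1 = 1 ->
  invariant_under act (propiwahori v) x.
Proof.
move=> xE chi1 g /propiwahori_gl2 [a [b [c [d [-> [aO bO cm dO] [ra rd]]]]]].
by rewrite xE // ?ra ?rd ?oner_neq0 // chi1 scale1r.
Qed.

Lemma vt1_eigen : iwahori_eigen (fun _ _ => 1) (vt 1%g).
Proof. by move=> a b c d *; rewrite scale1r act_vt1. Qed.

Lemma vt_beta_eigen : iwahori_eigen (fun _ _ => 1) (vt bt).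
Proof. by move=> a b c d *; rewrite scale1r act_vt_beta. Qed.

Lemma s_tau_eigen n : iwahori_eigen (fun a d => phi (d / a)) (s_tau n.+1).
Proof. by move=> a b c d *; rewrite act_s_tau // -fmorphV invf_div. Qed.

Lemma beta_s_tau_eigen n :
  iwahori_eigen (fun a d => phi (a / d)) (act bt (s_tau n.+1)).
Proof. by move=> a b c d *; rewrite act_beta_s_tau // -fmorphV invf_div. Qed.

Lemma cls_s_vec (iota : kF -> k) r n : (forall a, phi a = iota a ^+ r) ->
  cls (s_vec v varpi teich iota n.+1 r) = s_tau n.
Proof.
move=> phiE; rewrite /s_vec cls_sum sum_tuple_rcons; apply: eq_bigr => mu _.
apply: eq_bigr => a _; rewrite /= nth_rcons size_tuple ltnn eqxx -phiE.
by rewrite of_digits_rcons; exact: linearZ.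
Qed.

Local Notation H := ({unit kF} * {unit kF})%type.
Local Notation diagH := (diagH teich).

Lemma unit_neq0 (u : {unit kF}) : val u != 0.
Proof. by rewrite -unitfE (valP u). Qed.

Lemma card_units1 : #|{: H}|%:R = 1 :> k.
Proof.
have E : #|{: {unit kF}}|.+1 = #|kF|.
  by rewrite -cardsT card_finField_unit prednK // (ltn_trans _ card_gt3).
have N1 : #|{: {unit kF}}|%:R = -1 :> k.
  by apply/eqP; rewrite -subr_eq0 opprK natr1 E card_natr0k.
by rewrite card_prod natrM N1 mulrNN mulr1.
Qed.

(** Orthogonality of the characters of [H]; the order [(q - 1) ^ 2] of [H] is [1]
    in [k]. *)
Lemma hecke_e_eigen (iota : {rmorphism kF -> k}) (chi psi : H -> {unit kF}) ev x :
    is_char_of_H chi -> is_char_of_H psi -> iwahori_eigen ev x ->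
    (forall h, ev (val h.1) (val h.2) = iota (val (psi h))) ->
  hecke_e teich iota act chi x = if `[< chi =1 psi >] then x else 0.
Proof.
move=> chiM psiM xE evE; rewrite /hecke_e card_units1 invr1 scale1r.
have diagE h : act (diagH h)^-1%g x = (iota (val (psi h)))^-1 *: x.
  have c0 : iota (val (psi h)) != 0 by rewrite fmorph_eq0 unit_neq0.
  rewrite -[in RHS](act1 x) -(mulVg (diagH h)) actM.
  rewrite xE ?rpred0 ?maxideal0 ?red_teich ?unit_neq0 ?teichO // evE.
  by rewrite actZ scalerA mulVf // scale1r.
pose f h := iota (val (chi h) / val (psi h)).
transitivity ((\sum_h f h) *: x).
  rewrite scaler_suml; apply: eq_bigr => h _.
  by rewrite diagE scalerA -fmorphV -rmorphM.
case: asboolP => [cp|/existsNP[h0 h0E]].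
  have -> : \sum_h f h = \sum_(h : H) 1.
    by apply: eq_bigr => h _; rewrite /f cp divff ?rmorph1 ?unit_neq0.
  by rewrite sumr_const card_units1 scale1r.
suff -> : \sum_h f h = 0 by rewrite scale0r.
apply: (@sum_eigen0 _ _ f (fun h => (h0.1 * h.1, h0.2 * h.2)%g) (f h0))
  => [[a b] [a' b']||h].
- move=> E; have /= /mulgI -> := congr1 fst E.
  by have /= /mulgI -> := congr1 snd E.
- rewrite /f -(rmorph1 iota) (inj_eq (fmorph_inj iota)).
  by apply/negP => /eqP /divr1_eq /val_inj.
- by rewrite /f chiM psiM -rmorphM; congr (iota _); rewrite /= invfM mulrACA.
Qed.

End Quotient.
End LocalField.

(** * Finite extensions of Q_p *)

(** The p^l-th power is absorbed into the coefficient embedding, which makes the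
    weights additive. *)
Lemma frobenius_twist (p : nat) (kF k : fieldType) (iota : {rmorphism kF -> k}) l :
  p \in [pchar kF] ->
  exists phi : {rmorphism kF -> k}, forall a, phi a = iota a ^+ (p ^ l).
Proof.
move=> pF; elim: l => [|l [phi phiE]]; first by exists iota => a; rewrite expr1.
exists (phi \o pFrobenius_aut pF) => a /=.
by rewrite phiE pFrobenius_autE rmorphXn -exprM expnS.
Qed.

(** The valuation of [p ^ f] is [e * f]. *)
Lemma card_residue_deep (p : nat) (Qp : fieldType) (w : nvaluation Qp)
    (F : fieldExtType Qp) (v : nvaluation F) (e f : nat) (varpi : F) :
    prime p -> is_Qp p w -> ramification_index w v e -> uniformizer v varpi ->
    (1 < e * f)%N ->
  exists2 z, z \in integers v & (p ^ f)%:R = varpi ^+ 2 * z.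
Proof.
move=> hp hQp [e0 he] [pi0 vpi] hef.
have p0 : p%:R != 0 :> Qp by rewrite (Qp_char0 hQp) ?prime_gt0.
have pE : (p%:R : Qp)%:A = p%:R :> F by rewrite scaler_nat.
have vp : v p%:R = e%:Z.
  by rewrite -pE he // (Qp_val hQp) ?prime_gt0 // logn_prime // eqxx mulr1.
have pF0 : p%:R != 0 :> F by rewrite -pE scaler_eq0 negb_or p0 oner_neq0.
have vX (x : F) n : x != 0 -> v (x ^+ n) = v x *+ n.
  move=> x0; elim: n => [|n IHn]; first by rewrite expr0 nval1.
  by rewrite exprS nvalM ?expf_neq0 // IHn mulrS.
have q0 : (p ^ f)%:R / varpi ^+ 2 != 0 :> F.
  by rewrite natrX mulf_neq0 ?invr_eq0 ?expf_neq0.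
exists ((p ^ f)%:R / varpi ^+ 2); last by rewrite mulrC divfK ?expf_neq0.
have := nvalM v q0 (expf_neq0 2 pi0); rewrite divfK ?expf_neq0 //.
rewrite natrX !vX // vp vpi inE /val_ge => E; apply/orP; right.
have EN : e%:Z *+ f = (e * f)%N by rewrite -mulr_natr natz.
by move: E; rewrite EN; lia.
Qed.

Section Characters.
Variable kF : finFieldType.

Lemma val_char_d_over_a m (h : {unit kF} * {unit kF}) :
  val (char_d_over_a m h) = (val h.2 / val h.1) ^+ m.
Proof.
rewrite /char_d_over_a FinRing.val_unitM FinRing.val_unitV !FinRing.val_unitX.
by rewrite mulrC -exprVn exprMn.
Qed.

Lemma val_char_a_over_d m (h : {unit kF} * {unit kF}) :
  val (char_a_over_d m h) = (val h.1 / val h.2) ^+ m.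
Proof.
rewrite /char_a_over_d FinRing.val_unitM FinRing.val_unitV !FinRing.val_unitX.
by rewrite -exprVn exprMn.
Qed.

Lemma char1_is_char : is_char_of_H (@char1 kF).
Proof. by move=> x y; rewrite /char1 mulg1. Qed.

Lemma char_d_over_a_is_char m : is_char_of_H (@char_d_over_a kF m).
Proof.
move=> x y; apply: val_inj; rewrite FinRing.val_unitM !val_char_d_over_a.
by rewrite !FinRing.val_unitM -exprMn invfM mulrACA.
Qed.

Lemma char_a_over_d_is_char m : is_char_of_H (@char_a_over_d kF m).
Proof.
move=> x y; apply: val_inj; rewrite FinRing.val_unitM !val_char_a_over_d.
by rewrite !FinRing.val_unitM -exprMn invfM mulrACA.
Qed.

End Characters.

Theorem mainTheorem4
  (p : nat) (hp : prime p)
  (Qp : fieldType) (w : nvaluation Qp) (hQp : is_Qp p w)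
  (F : fieldExtType Qp) (v : nvaluation F)
  (e : nat) (he : ramification_index w v e)
  (varpi : F) (hvarpi : uniformizer v varpi)
  (kF : finFieldType) (red : F -> kF) (hred : residue_map v red)
  (f : nat) (hf : #|kF| = (p ^ f)%N)
  (teich : kF -> F) (hteich : teichmuller v red teich)
  (Fpbar : closedFieldType) (j : {rmorphism 'F_p -> Fpbar})
  (hj : integralRange j) (iota : {rmorphism kF -> Fpbar})
  (hef : (1 < e * f)%N) (hq : (3 < #|kF|)%N) :
  let tau := tau v varpi teich Fpbar in
  let b : GL2 F := beta varpi in
  let act : GL2 F -> tau -> tau := @tau_act F v varpi kF teich Fpbar in
  let cl : indIZ v Fpbar -> tau := cls varpi teich in
  let id1 : tau := cl (br v Fpbar 1%g) in
  let beta1 : tau := cl (br v Fpbar b) in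
  let s (n l : nat) : tau := cl (s_vec v varpi teich iota n (p ^ l)) in
  let beta_s (n l : nat) : tau := act b (s n l) in
  let inI1 (x : tau) : Prop := invariant_under act (propiwahori v) x in
  let T_beta : tau -> tau := hecke_beta varpi act in
  let T_ns : tau -> tau := hecke_ns teich act in
  let e_ (chi : {unit kF} * {unit kF} -> {unit kF}) : tau -> tau :=
    hecke_e teich iota act chi in
  [/\ [/\ inI1 id1, inI1 beta1 &
          forall n l : nat, (2 <= n)%N -> (l < f)%N ->
            inI1 (s n l) /\ inI1 (beta_s n l)],
      [/\ T_beta id1 = beta1, T_beta beta1 = id1 &
          forall n l : nat, (2 <= n)%N -> (l < f)%N ->
            T_beta (s n l) = beta_s n l /\ T_beta (beta_s n l) = s n l],
      [/\ T_ns id1 = 0, T_ns beta1 = - beta1 &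
          forall n l : nat, (2 <= n)%N -> (l < f)%N ->
            T_ns (s n l) = 0 /\ T_ns (beta_s n l) = - s n.+1 l]
    & forall chi : {unit kF} * {unit kF} -> {unit kF}, is_char_of_H chi ->
      [/\ e_ chi id1 = (if `[< chi =1 @char1 kF >] then id1 else 0),
          e_ chi beta1 = (if `[< chi =1 @char1 kF >] then beta1 else 0) &
          forall n l : nat, (2 <= n)%N -> (l < f)%N ->
            e_ chi (s n l) =
              (if `[< chi =1 char_d_over_a (p ^ l) >] then s n l else 0) /\
            e_ chi (beta_s n l) =
              (if `[< chi =1 char_a_over_d (p ^ l) >] then beta_s n l else 0)]].
Proof.
have card_deep : exists2 z, z \in integers v & #|kF|%:R = varpi ^+ 2 * z.
  by rewrite hf; apply: card_residue_deep hp hQp he hvarpi hef.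
have pF : p \in [pchar kF].
  rewrite inE hp; have /eqP := card_natr0 kF.
  by rewrite hf natrX expf_eq0 => /andP[].
have tw l := frobenius_twist iota l pF.
move=> tau b act cl id1 beta1 s beta_s inI1 T_beta T_ns e_.
have sE n l (phi : {rmorphism kF -> Fpbar}) :
    (forall a, phi a = iota a ^+ (p ^ l)) -> s n.+1 l = s_tau v varpi teich phi n.
  by move=> phiE; apply: cls_s_vec.
split.
- split.
  + by apply: (eigen_invariant hred (vt1_eigen hvarpi hred hteich Fpbar)).
  + by apply: (eigen_invariant hred (vt_beta_eigen hvarpi hred hteich Fpbar)).
  case=> [|[|n]] // l _ _; have [phi phiE] := tw l; rewrite /beta_s (sE _ _ _ phiE).
  split.
    apply: (eigen_invariant hred
      (s_tau_eigen hvarpi hred hteich phi card_deep hq n)).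
    by rewrite divff ?oner_neq0 ?rmorph1.
  apply: (eigen_invariant hred
    (beta_s_tau_eigen hvarpi hred hteich phi card_deep hq n)).
  by rewrite divff ?oner_neq0 ?rmorph1.
- have TE x : T_beta x = act b x by exact (act_betaV hvarpi hred hteich x).
  have bb x : act b (act b x) = x by exact (act_betaK hvarpi hred hteich x).
  have b1 : act b id1 = beta1.
    by rewrite /act /id1 (act_vt hvarpi hred hteich) mulg1.
  split; rewrite ?TE //; first by rewrite -b1 bb.
  by move=> n l _ _; rewrite !TE /beta_s bb.
- split.
  + exact (ns_vt1 hvarpi hred hteich iota).
  + exact (ns_vt_beta hvarpi hred hteich iota).
  case=> [|[|n]] // l _ _; have [phi phiE] := tw l; rewrite /beta_s !(sE _ _ _ phiE).
  split; first exact (ns_s_tau hvarpi hred hteich phi card_deep hq n).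
  exact (ns_beta_s_tau hvarpi hred hteich phi card_deep hq n.+1).
- move=> chi chiP; split.
  + apply: (hecke_e_eigen hvarpi hred hteich iota hq chiP (@char1_is_char kF)
      (vt1_eigen hvarpi hred hteich Fpbar)) => h.
    by rewrite /char1 /= rmorph1.
  + apply: (hecke_e_eigen hvarpi hred hteich iota hq chiP (@char1_is_char kF)
      (vt_beta_eigen hvarpi hred hteich Fpbar)) => h.
    by rewrite /char1 /= rmorph1.
  case=> [|[|n]] // l _ _; have [phi phiE] := tw l; rewrite /beta_s (sE _ _ _ phiE).
  split.
    apply: (hecke_e_eigen hvarpi hred hteich iota hq chiP (@char_d_over_a_is_char kF _)
      (s_tau_eigen hvarpi hred hteich phi card_deep hq n)) => h.
    by rewrite phiE val_char_d_over_a rmorphXn.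
  apply: (hecke_e_eigen hvarpi hred hteich iota hq chiP (@char_a_over_d_is_char kF _)
    (beta_s_tau_eigen hvarpi hred hteich phi card_deep hq n)) => h.
  by rewrite phiE val_char_a_over_d rmorphXn.
Qed.
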